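(* Let $G$ be a $3$-connected planar bipartite graph. Then $G$ admits a proper orientation with maximum indegree at most $6$.
   Context: All graphs are finite and simple. An orientation of a graph replaces each edge by exactly one of its two possible arcs; the indegree of a vertex is the number of arcs with that vertex as head. An orientation is proper if any two adjacent vertices have different indegrees. *)

(* Defs.v *)
From mathcomp Require Import all_boot all_order all_algebra.
From mathcomp Require Import all_classical all_reals all_analysis.

Set Implicit Arguments.
Unset Strict Implicit.
Unset Printing Implicit Defensive.

Import Order.TTheory GRing.Theory Num.Theory.
Import numFieldNormedType.Exports.

Local Open Scope classical_set_scope.
Local Open Scope ring_scope.

(* A finite simple graph is a symmetric irreflexive relation [e] on a finite
   type [T]; symmetry and irreflexivity are assumed where theorems need them. *)

Section Graphs.
Variables (T : finType) (e : rel T).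

Definition bipartite : Prop :=
  exists A : {set T}, forall x y, e x y -> (x \in A) != (y \in A).

Definition connected_avoiding (S : {set T}) : Prop :=
  forall x y, x \notin S -> y \notin S ->
    connect [rel a b | [&& e a b, a \notin S & b \notin S]] x y.

Definition k_connected (k : nat) : Prop :=
  (k < #|T|)%N /\
  (forall S : {set T}, (#|S| < k)%N -> connected_avoiding S).

(* [o x y] means that the edge xy is replaced by the arc with tail x and
   head y. *)
Definition orientation (o : rel T) : Prop :=
  (forall x y, o x y -> e x y) /\
  (forall x y, e x y -> o x y (+) o y x).

Definition indegree (o : rel T) (y : T) : nat := #|[pred x | o x y]|.

Definition proper_orientation (o : rel T) : Prop :=
  orientation o /\ (forall x y, e x y -> indegree o x <> indegree o y).

End Graphs.

Section Planarity.
Variable R : realType.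

Definition arc_between (p q : R * R) (C : set (R * R)) : Prop :=
  exists g : R -> R * R,
    [/\ {within `[0, 1], continuous g}, {in `[0, 1]%R &, injective g},
        g 0 = p, g 1 = q & C = g @` `[0, 1]].

Variables (T : finType) (e : rel T).

(* The edge uv is drawn as the curve [C [set u; v]]; indexing curves by
   unordered pairs gives each edge a single curve, whichever end is named
   first.  Only the values of [C] at edges are constrained. *)
Definition plane_drawing (pos : T -> R * R) (C : {set T} -> set (R * R)) :
    Prop :=
  [/\ injective pos,
      forall u v, e u v -> arc_between (pos u) (pos v) (C [set u; v]%SET),
      forall u v w, e u v -> C [set u; v]%SET (pos w) ->
        w \in [set u; v]%SET
    & forall u v x y, e u v -> e x y -> [set u; v]%SET != [set x; y]%SET ->
        C [set u; v]%SET `&` C [set x; y]%SET `<=`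
        [set pos w | w in [set` ([set u; v] :&: [set x; y])%SET]]].

Definition planar : Prop := exists pos C, plane_drawing pos C.

End Planarity.

(* Main.v *)
(* The even edge sets of a planar graph are the boundaries of the sets of faces,
   and such a combinatorial dual is all that is used of planarity.  Laid over a fine enough
   square grid, a plane drawing exhibits the graph as a minor of the grid; the
   grid has an evident dual, and duals pass to minors by merging the faces on
   the two sides of a deleted edge.  A dual gives Euler's inequality, hence at
   most [2 n - 2] edges in a simple bipartite graph on [n] vertices.  Applied to
   [G[W]], and to the bipartite minor obtained from [G] by contracting the
   components of [G - W], each of which has three neighbours in [W] by
   3-connectivity, this yields [e(W) + c(G - W) < 4 |W|].

   A connected graph can be oriented with prescribed indegree parities as soon
   as the total parity is right.  Among such orientations take one with least
   excess over 6.  Grow vertex sets in which any two parity defects can be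
   corrected without exceeding 6; a vertex [w] outside them has indegree at least
   5, so by the inequality there are enough arcs into the set [W] of these
   vertices to close a cycle, and reversing the cycle frees its vertices.  Hence
   [W] is empty, and the excess is 0.

   Let the indegrees be odd on the side [A] of a vertex [v] and even on the other
   side.  If the total parity forbids this, make [v] a source instead: its
   neighbours then have positive indegrees, and removing [v] fixes the parity. *)

Require Import Defs.
From mathcomp Require Import all_boot zify boolp.

Set Implicit Arguments.
Unset Strict Implicit.
Unset Printing Implicit Defensive.

(** * Even edge sets and combinatorial duals *)

Local Notation "\xor_ ( i | P ) F" := (\big[addb/false]_(i | P%B) F%B)
  (at level 41, F at level 41, i, P at level 60).
Local Notation "\xor_ i F" := (\big[addb/false]_i F%B)
  (at level 41, F at level 41, i at level 0).

Section Xor.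
Variable T : finType.
Implicit Types (x y v : T) (z t : rel T).

Lemma xor_card (P : pred T) : odd #|P| = \xor_x P x.
Proof.
rewrite -sum1_card (big_morph odd oddD (erefl _)) big_mkcond.
by apply: eq_bigr => x _; rewrite unfold_in; case: (P x).
Qed.

Lemma xor_pred1 (c : bool) x : \xor_y (c && (y == x)) = c.
Proof.
rewrite (bigD1 x) //= eqxx andbT big1 ?addbF // => y /negPf ->.
by rewrite andbF.
Qed.

Lemma xor_sym (P : pred T) (F : rel T) :
  symmetric F -> irreflexive F -> \xor_(x | P x) \xor_(y | P y) F x y = false.
Proof.
move=> Fs Fi.
pose G x y := F x y && (enum_rank x < enum_rank y).
have FG x y : F x y = G x y (+) G y x.
  rewrite /G (Fs y x); case: (ltngtP (enum_rank x) (enum_rank y)) => [_|_|/val_inj/enum_rank_inj->].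
  - by rewrite andbT andbF addbF.
  - by rewrite andbT andbF.
  - by rewrite !andbF Fi.
transitivity (\xor_(x | P x) (\xor_(y | P y) G x y (+) \xor_(y | P y) G y x)).
  by apply: eq_bigr => x _; rewrite -big_split; apply: eq_bigr.
rewrite big_split /= [X in _ (+) X]exchange_big /=; exact: addbb.
Qed.

(** Edge sets are symmetric relations added by exclusive or; this is the boundary map of the graph
    over the field with two elements. *)
Definition boundary z v := \xor_y z v y.

Lemma boundary_xor z t v :
  boundary (fun x y => z x y (+) t x y) v = boundary z v (+) boundary t v.
Proof. exact: big_split. Qed.

Lemma eq_boundary z t v : z v =1 t v -> boundary z v = boundary t v.
Proof. by move=> zt; apply: eq_bigr => y _; apply: zt. Qed.

Lemma handshake z : symmetric z -> irreflexive z -> \xor_x boundary z x = false.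
Proof. by move=> zs zi; exact: (@xor_sym predT). Qed.

(* The exclusive or makes the loop [x = y] the empty edge set. *)
Definition edge x y : rel T :=
  fun a b => ((a == x) && (b == y)) (+) ((a == y) && (b == x)).

Lemma edge_sym x y : symmetric (edge x y).
Proof.
by move=> a b; rewrite /edge addbC andbC [in X in _ (+) X]andbC.
Qed.

Lemma edgeC x y a b : edge x y a b = edge y x a b.
Proof. by rewrite /edge addbC. Qed.

Lemma edgeP x y a b : edge x y a b -> (a = x /\ b = y) \/ (a = y /\ b = x).
Proof.
rewrite /edge; case: andP => [[/eqP-> /eqP->]|_] /=; first by left.
by case/andP=> /eqP-> /eqP->; right.
Qed.

Lemma boundary_edge x y v : boundary (edge x y) v = (v == x) (+) (v == y).
Proof. by rewrite /boundary big_split /= !xor_pred1. Qed.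

(** The edges of a path are added mod 2 and their boundaries telescope; repeated edges cancel, so
    any walk will do. *)
Lemma connect_join (R : rel T) x y : symmetric R -> connect R x y ->
  exists t, [/\ symmetric t, subrel t R &
    forall v, boundary t v = (v == x) (+) (v == y)].
Proof.
move=> Rs /connectP[p]; elim: p x => [|x' p IH] x /=.
  move=> _ ->; exists (fun _ _ => false); split=> // v.
  by rewrite /boundary big1 // addbb.
case/andP=> Rx /IH{}IH /IH[t [ts tR tb]].
exists (fun a b => edge x x' a b (+) t a b); split.
- by move=> a b; rewrite edge_sym ts.
- move=> a b; case tab: (t a b); first by move=> _; apply: tR.
  by rewrite addbF => /edgeP[[-> ->] //|[-> ->]]; rewrite Rs.
- move=> v; rewrite boundary_xor boundary_edge tb.
  by rewrite addbA addbK.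
Qed.

(** Existence of T-joins: each vertex of [b] is joined to one root [r] and the paths are added.
    Their number is even, so nothing is left over at [r]. *)
Lemma join_exists (R : rel T) (B : {set T}) (b : pred T) :
  symmetric R -> {in B &, forall x y, connect R x y} ->
  (forall x, b x -> x \in B) -> \xor_x b x = false ->
  exists t, [/\ symmetric t, subrel t R & forall v, boundary t v = b v].
Proof.
move=> Rs Bc bB b0; case: (pickP (mem B)) => [r rB|Be]; last first.
  exists (fun _ _ => false); split=> // v.
  rewrite /boundary big1 //; apply/esym/negbTE/negP => /bB vB.
  by have:= Be v; rewrite /= vB.
have /fin_all_exists[t tP] x : exists t : rel T, b x ->
    [/\ symmetric t, subrel t R & forall v, boundary t v = (v == x) (+) (v == r)].
  case bx: (b x); last by exists (fun _ _ => false).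
  have [t tP] := connect_join Rs (Bc x r (bB x bx) rB).
  by exists t.
exists (fun a c => \xor_x (b x && t x a c)); split.
- move=> a c; apply: eq_bigr => x _; case bx: (b x) => //=.
  by have [-> _ _] := tP x bx.
- move=> a c; apply: contraTT => nR; apply/negP.
  rewrite big1 // => x _; case bx: (b x) => //=.
  by have [_ tR _] := tP x bx; apply/negbTE; apply: contra nR; apply: tR.
- move=> v; rewrite /boundary exchange_big /=.
  transitivity (\xor_x (b x && (x == v) (+) b x && (v == r))).
    apply: eq_bigr => x _; case bx: (b x) => /=; last by rewrite big1.
    by have [_ _] := tP x bx; rewrite /boundary => ->; rewrite eq_sym.
  rewrite big_split /= -big_distrl /= b0 addbF.
  rewrite (bigD1 v) //= eqxx andbT big1 ?addbF // => y /negPf ->.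
  by rewrite andbF.
Qed.

End Xor.

(** * Combinatorial duals pass to minors *)

Section Dual.

Definition delta (V L : Type) (e : rel V) (l r : V -> V -> L) (phi : pred L) :
    rel V :=
  fun x y => e x y && (phi (l x y) (+) phi (r x y)).

(* A combinatorial dual: the two faces at each edge are [l] and [r], and the
   even edge sets are exactly the boundaries of sets of faces. *)
Definition has_dual (V : finType) (e : rel V) : Prop :=
  exists (L : finType) (l r : V -> V -> L),
    [/\ forall x y, l x y = l y x, forall x y, r x y = r y x,
        forall phi x, boundary (delta e l r phi) x = false &
        forall z, symmetric z -> subrel z e -> (forall x, boundary z x = false) ->
          exists phi, z =2 delta e l r phi].

Variables (V U : finType) (e : rel V) (h : rel U) (B : U -> {set V}).
Hypotheses (e_sym : symmetric e) (e_irr : irreflexive e).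
Hypotheses (h_sym : symmetric h) (h_irr : irreflexive h).
Hypothesis B_disj : forall u u' x, x \in B u -> x \in B u' -> u = u'.
Hypothesis B_conn : forall u, {in B u &, forall x y,
  connect [rel a b | [&& e a b, a \in B u & b \in B u]] x y}.
Hypothesis B_edge : forall u u', h u u' ->
  exists x y, [/\ x \in B u, y \in B u' & e x y].


Lemma ports_exist (x0 : V) : exists p : U -> U -> V, forall u u', h u u' ->
  (p u u' \in B u) && e (p u u') (p u' u).
Proof.
have /fin_all_exists[q qP] (w : U * U) : exists xy : V * V, h w.1 w.2 ->
    [&& xy.1 \in B w.1, xy.2 \in B w.2 & e xy.1 xy.2].
  case hw: (h w.1 w.2); last by exists (x0, x0).
  by have [x [y [xB yB xy]]] := B_edge hw; exists (x, y); rewrite /= xB yB.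
(* Ranks select one order of each pair, so [p u u'] and [p u' u] are the two ends of the same
   edge. *)
exists (fun u u' => if enum_rank u < enum_rank u' then (q (u, u')).1
                    else (q (u', u)).2) => u u' huu'.
have hu'u : h u' u by rewrite h_sym.
have := qP (u, u') huu'; have := qP (u', u) hu'u => /=.
case: (ltngtP (enum_rank u) (enum_rank u')) => [||/val_inj/enum_rank_inj uu'] /=.
- by move=> _ _ /and3P[-> _ ->].
- by move=> _ /and3P[_ -> eq] _; rewrite e_sym.
- by move: huu'; rewrite uu' h_irr.
Qed.

(** Contracting an edge leaves the faces alone; deleting one merges the two faces beside it. The
    edges of [e] are split into [kept] ones, one for each edge of [h], contracted ones inside branch
    sets, and deleted ones; [q] names the merged faces. *)
Lemma minor_dual : has_dual e -> has_dual h.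
Proof.
move=> [L [l [r [ls rs dE dS]]]].
have [x0 _|V0] := pickP V; last first.
  have h0 u u' : h u u' = false.
    by apply/negP => /B_edge[x _]; have := V0 x.
  exists unit, (fun _ _ => tt), (fun _ _ => tt); split=> //.
    by move=> phi u; rewrite /boundary big1 // => u' _; rewrite /delta h0.
  move=> z _ zh _; exists predT => u u'; rewrite /delta h0 /=.
  by apply/negP => /zh; rewrite h0.
have [p pP] := ports_exist x0.
have pB u u' : h u u' -> p u u' \in B u by move=> /pP/andP[].
have pe u u' : h u u' -> e (p u u') (p u' u) by move=> /pP/andP[].
pose kept x y := [exists u, exists u', [&& h u u', x == p u u' & y == p u' u]].
have keptP x y : reflect (exists u u', [/\ h u u', x = p u u' & y = p u' u])
    (kept x y).
  apply: (iffP existsP) => [[u /existsP[u' /and3P[? /eqP? /eqP?]]]|].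
    by exists u, u'.
  by move=> [u [u' [huu' -> ->]]]; exists u; apply/existsP; exists u'; rewrite huu' !eqxx.
have kept_sym : symmetric kept.
  have imp x y : kept x y -> kept y x.
    by case/keptP=> u [u' [huu' -> ->]]; apply/keptP; exists u', u; rewrite h_sym.
  by move=> x y; apply/idP/idP; apply: imp.
pose inner x y := [exists u, [&& e x y, x \in B u & y \in B u]].
have inner_sym : symmetric inner.
  by move=> x y; apply: eq_existsb => u; rewrite e_sym [(x \in _) && _]andbC.
pose dele x y := [&& e x y, ~~ kept x y & ~~ inner x y].
have dele_sym : symmetric dele.
  by move=> x y; rewrite /dele e_sym kept_sym inner_sym.
pose d w w' := [exists x, exists y, dele x y &&
  (((w == l x y) && (w' == r x y)) || ((w' == l x y) && (w == r x y)))].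
have d_sym : symmetric d.
  by move=> w w'; apply: eq_existsb => x; apply: eq_existsb => y; rewrite orbC.
have cd_sym : connect_sym d by apply: sym_connect_sym.
pose q := root d.
have q_dele x y : dele x y -> q (l x y) = q (r x y).
  move=> dxy; apply/(rootP cd_sym)/connect1/existsP; exists x.
  by apply/existsP; exists y; rewrite dxy !eqxx.
have kept_out u x y : x \in B u -> kept x y ->
    exists u', [/\ h u u', x = p u u' & y = p u' u].
  move=> xu /keptP[u1 [u2 [h12 xE yE]]].
  have -> : u = u1 by apply: B_disj xu _; rewrite xE pB.
  by exists u2.
exists L, (fun u u' => q (l (p u u') (p u' u))), (fun u u' => q (r (p u u') (p u' u))).
split.
- by move=> u u'; rewrite ls.
- by move=> u u'; rewrite rs.
- move=> phi u; set Z := delta _ _ _ _.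
  (* The boundary of the pulled-back face set is summed over [B u]: pairs inside [B u] cancel,
     deleted edges have the same merged face on both sides, and the kept edges leaving [B u]
     remain. *)
  pose z := delta e l r (phi \o q).
  have z_sym : symmetric z by move=> x y; rewrite /z /delta e_sym ls rs.
  have z_irr : irreflexive z by move=> x; rewrite /z /delta e_irr.
  have : \xor_(x | x \in B u) boundary z x = false by rewrite big1 // => x _; apply: dE.
  have -> : \xor_(x | x \in B u) boundary z x =
      \xor_(x | x \in B u) \xor_(y | y \notin B u) z x y.
    transitivity (\xor_(x | x \in B u) (\xor_(y | y \in B u) z x y (+)
                   \xor_(y | y \notin B u) z x y)).
      by apply: eq_bigr => x xu; rewrite /boundary (bigID (mem (B u))).
    by rewrite big_split /= xor_sym.
  rewrite pair_big /= => z0.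
  rewrite -[RHS]z0 [RHS](bigID (fun w => kept w.1 w.2)) /= [X in _ (+) X]big1 ?addbF; last first.
    move=> [x y] /= /andP[/andP[xu yu] nk]; rewrite /z /delta.
    case exy: (e x y) => //=; rewrite (q_dele x y) ?addbb //.
    rewrite /dele exy nk; apply/existsP => -[u' /and3P[_ xu' yu']].
    by rewrite (B_disj xu xu') yu' in yu.
  rewrite /boundary (bigID (h u)) /= [X in _ (+) X]big1 ?addbF; last first.
    by move=> u' /negPf hu; rewrite /Z /delta hu.
  rewrite (eq_bigl (mem [set (p u u', p u' u) | u' in h u])); last first.
    move=> [x y] /=; apply/idP/imsetP.
      move=> /andP[/andP[xu _] kxy]; have [u' [huu' -> ->]] := kept_out _ _ _ xu kxy.
      by exists u'.
    move=> [u']; rewrite unfold_in => huu' [-> ->]; rewrite pB //= andbC.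
    apply/andP; split; first by apply/keptP; exists u, u'.
    apply/negP => /B_disj - /(_ u'); rewrite pB 1?h_sym // => /(_ isT) uu'.
    by rewrite uu' h_irr in huu'.
  rewrite big_imset /=; last first.
    move=> u1 u2; rewrite !unfold_in => h1 h2 [_ E].
    by apply: (B_disj (x := p u1 u)); [|rewrite E]; rewrite pB 1?h_sym.
  by apply: eq_bigr => u' hu; rewrite /Z /z /delta hu pe.
- move=> z z_sym zh z0.
  (* [Z] copies [z] to the kept edges. Its total boundary on each branch set is even, so a join
     inside [B u] can make every vertex even. *)
  pose Z x y := [exists u, exists u', [&& h u u', x == p u u', y == p u' u & z u u']].
  have Zp u u' : h u u' -> Z (p u u') (p u' u) = z u u'.
    move=> huu'; apply/existsP/idP.
      move=> [u1 /existsP[u2 /and4P[h12 /eqP E1 /eqP E2]]].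
      have -> : u1 = u by apply: (B_disj (x := p u u')); rewrite ?pB // E1 pB.
      have -> // : u2 = u'.
      by apply: (B_disj (x := p u' u)); rewrite ?pB 1?h_sym // E2 pB 1?h_sym.
    by move=> zuu'; exists u; apply/existsP; exists u'; rewrite huu' !eqxx.
  have Zk x y : Z x y -> kept x y.
    move=> /existsP[u /existsP[u' /and4P[huu' /eqP-> /eqP-> _]]].
    by apply/keptP; exists u, u'.
  have Z_sym : symmetric Z.
    have imp x y : Z x y -> Z y x.
      move=> /existsP[u /existsP[u' /and4P[huu' xE yE zz]]].
      apply/existsP; exists u'; apply/existsP; exists u.
      by rewrite h_sym huu' xE yE z_sym.
    by move=> x y; apply/idP/idP; apply: imp.
  have bZ u : \xor_(x | x \in B u) boundary Z x = false.
    rewrite -[RHS](z0 u) /boundary pair_big_dep /=.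
    rewrite [LHS](bigID (fun w => kept w.1 w.2)) /= [X in _ (+) X]big1 ?addbF; last first.
      move=> [x y] /= /andP[_ nk]; apply: contraNF nk; exact: Zk.
    rewrite [RHS](bigID (h u)) /= [X in _ = _ (+) X]big1 ?addbF; last first.
      by move=> u' nh; apply: contraNF nh; apply: zh.
    rewrite (eq_bigl (mem [set (p u u', p u' u) | u' in h u])); last first.
      move=> [x y] /=; apply/idP/imsetP.
        rewrite andbT => /andP[xu kxy]; have [u' [huu' -> ->]] := kept_out _ _ _ xu kxy.
        by exists u'.
      move=> [u']; rewrite unfold_in => huu' [-> ->]; rewrite pB //=.
      by apply/keptP; exists u, u'.
    rewrite big_imset /=; last first.
      move=> u1 u2; rewrite !unfold_in => h1 h2 [_ E].
      by apply: (B_disj (x := p u1 u)); [|rewrite E]; rewrite pB 1?h_sym.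
    by apply: eq_bigr => u' hu; rewrite Zp.
  have /fin_all_exists[t tP] u : exists t : rel V, [/\ symmetric t,
      subrel t [rel a b | [&& e a b, a \in B u & b \in B u]] &
      forall x, boundary t x = (x \in B u) && boundary Z x].
    apply: (join_exists (B := B u)).
    - by move=> x y /=; rewrite e_sym [(x \in _) && _]andbC.
    - exact: B_conn.
    - by move=> x /andP[].
    - by rewrite -[RHS](bZ u) [RHS]big_mkcond; apply: eq_bigr => x _; case: ifP.
  pose Y x y := Z x y (+) \xor_u t u x y.
  have [||x|phi phiP] := dS Y.
  - move=> x y; rewrite /Y Z_sym; congr (_ (+) _).
    by apply: eq_bigr => u _; have [-> _ _] := tP u.
  - move=> x y; case Zxy: (Z x y).
      move=> _; have /keptP[u [u' [huu' -> ->]]] := Zk _ _ Zxy.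
      exact: pe.
    rewrite /Y Zxy; apply: contraTT => ne; rewrite big1 // => u _.
    have [_ te _] := tP u; apply: contraNF ne => /te /=.
    by case/and3P.
  - rewrite boundary_xor [X in _ (+) X]exchange_big /=.
    have -> : \xor_u \xor_y t u x y = \xor_u ((x \in B u) && boundary Z x).
      by apply: eq_bigr => u _; have [_ _] := tP u; apply.
    case: (pickP (fun u => x \in B u)) => [u xu|xN].
      rewrite (bigD1 u) //= xu big1 ?addbF ?addbb // => u' uu'.
      by apply: contraNF uu' => /andP[xu' _]; rewrite (B_disj xu xu').
    rewrite big1 ?addbF; last by move=> u _; rewrite xN.
    rewrite /boundary big1 // => y _; apply/negbTE/negP => Zxy.
    have /keptP[u [u' [huu' xE _]]] := Zk _ _ Zxy.
    by have := xN u; rewrite xE pB.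
  exists phi => u u'; rewrite /delta; case huu': (h u u') => /=; last first.
    by apply: contraFF huu'; apply: zh.
  (* The even set [Y] contains no deleted edge, so [phi] agrees on the two faces beside each of them
     and descends to merged faces. *)
  have phiq w : phi (q w) = phi w.
    rewrite /q; have /connectP[s ds ->] := connect_root d w.
    elim: s w ds => //= w' s IH w /andP[/existsP[x /existsP[y /andP[dxy E]]] ds].
    rewrite (IH _ ds).
    have /eqP : phi (l x y) (+) phi (r x y) = false.
      have := phiP x y; rewrite /delta; have /and3P[-> nk ni] := dxy => /= <-.
      rewrite /Y (contraNF (@Zk x y) nk) big1 // => u1 _.
      apply: contraNF ni => txy; apply/existsP; exists u1.
      by have [_ /(_ _ _ txy) ? _] := tP u1.
    by case/orP: E => /andP[/eqP-> /eqP->]; case: (phi (l x y)); case: (phi (r x y)).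
  rewrite !phiq -(Zp _ _ huu').
  have := phiP (p u u') (p u' u); rewrite /delta pe //= => <-.
  rewrite /Y big1 ?addbF // => u1 _.
  apply/negP; have [_ tE _] := tP u1 => /tE /and3P[_ a1 a2].
  have E1 := B_disj a1 (pB _ _ huu').
  have hu'u : h u' u by rewrite h_sym.
  by have := B_disj a2 (pB _ _ hu'u) => E2; rewrite -E1 -E2 h_irr in huu'.
Qed.

End Dual.

(** * Euler's inequality for bipartite graphs with a dual *)

Section Sparsity.
Variables (U : finType) (h : rel U) (A D : {set U}).
Hypotheses (h_sym : symmetric h).
Hypothesis h_bip : forall x y, h x y -> (x \in A) != (y \in A).
Hypothesis h_supp : forall x y, h x y -> x \in D.

Lemma bipartite_irr : irreflexive h.
Proof. by move=> x; apply/negP => /h_bip; rewrite eqxx. Qed.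

(** By bipartiteness each edge is listed exactly once, from its end in [A]. *)
Let E := [set a : U * U | h a.1 a.2 && (a.1 \in A)].

Lemma even_second (z : rel U) x y : boundary z x = false -> z x y ->
  exists2 y', y' != y & z x y'.
Proof.
move=> z0 zxy; apply/exists_inP; apply: contraFT z0 => /exists_inPn zN.
rewrite /boundary (bigD1 y) //= zxy big1 // => y' y'y.
by apply/negbTE/zN.
Qed.

(** Every edge of an even set has a second one beside it at each end. So [y] leads to a vertex [x2]
    other than [x] on the same side, and two edges at each of [x] and [x2] make four. *)
Lemma even_card_ge4 (z : rel U) x y : symmetric z -> subrel z h ->
  (forall v, boundary z v = false) -> z x y ->
  3 < #|[set a in E | z a.1 a.2]|.
Proof.
move=> z_sym zh z0.
wlog xA : x y / x \in A => [hw zxy|zxy].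
  have := h_bip (zh _ _ zxy); case xA: (x \in A); first by move=> _; apply: hw xA zxy.
  by move=> yA; apply: (hw y x); [case: (y \in A) yA|rewrite z_sym].
have inE' u v : u \in A -> z u v -> (u, v) \in [set a in E | z a.1 a.2].
  by move=> uA zuv; rewrite !inE /= uA zuv (zh _ _ zuv).
have [y2 y2y zxy2] := even_second (z0 x) zxy.
have [x2 x2x zyx2] := even_second (z0 y) (etrans (z_sym y x) zxy).
have zx2y : z x2 y by rewrite z_sym.
have [y3 y3y zx2y3] := even_second (z0 x2) zx2y.
have x2A : x2 \in A.
  have := h_bip (zh _ _ zxy); have := h_bip (zh _ _ zx2y).
  by rewrite xA; case: (x2 \in A); case: (y \in A).
have <- : #|[set (x, y); (x, y2); (x2, y); (x2, y3)]| = 4.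
  rewrite -!setUA !cardsU1 cards1 !inE !xpair_eqE !eqxx /= andbT.
  rewrite ![_ == x2]eq_sym (negPf x2x) /= ![y == _]eq_sym.
  by rewrite (negPf y2y) (negPf y3y).
apply/subset_leq_card/subsetP => a.
by rewrite 3!in_setU !in_set1 -!orbA => /or4P[] /eqP->; apply: inE'.
Qed.

Let zof (Q : {set U * U}) : rel U :=
  fun x y => ((x, y) \in Q) (+) ((y, x) \in Q).

Lemma zofE (Q : {set U * U}) x y : Q \subset E -> (x, y) \in E ->
  zof Q x y = ((x, y) \in Q).
Proof.
move=> QE; rewrite inE /= => /andP[hxy xA]; rewrite /zof.
have -> : (y, x) \in Q = false; last by rewrite addbF.
apply: contraTF (h_bip hxy) => /(subsetP QE).
by rewrite inE /= xA => /andP[_ ->].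
Qed.

Lemma zof_sub (Q : {set U * U}) : Q \subset E -> subrel (zof Q) h.
Proof.
move=> /subsetP QE x y; rewrite /zof.
case xyQ: (_ \in Q); first by have := QE _ xyQ; rewrite inE /= => /andP[].
by move=> /= /QE; rewrite inE /= h_sym => /andP[].
Qed.

Definition symdiff (T : finType) (Q R : {set T}) : {set T} :=
  [set a | (a \in Q) (+) (a \in R)].

Lemma symdiff_sub (T : finType) (Q R S : {set T}) :
  Q \subset S -> R \subset S -> symdiff Q R \subset S.
Proof.
move=> /subsetP QS /subsetP RS; apply/subsetP => a; rewrite inE.
by case: (boolP (a \in Q)) => [/QS //|_ /= /RS].
Qed.

Lemma zof_symdiff Q R x y :
  zof (symdiff Q R) x y = zof Q x y (+) zof R x y.
Proof. by rewrite /zof !inE addbACA. Qed.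

(* Euler's inequality [m <= (n - 1) + f], where [f] counts the faces that
   carry a nonempty edge set, by comparing [2 ^ m] edge sets with pairs of a
   vertex boundary and a set of faces; each face has at least four edges. *)
Lemma dual_sparse : has_dual h -> D != set0 -> #|E| + 2 <= 2 * #|D|.
Proof.
move=> [L [l [r [ls rs dE dS]]]] /set0Pn[r0 r0D].
pose F := [set w | [exists x, exists y, delta h l r (pred1 w) x y]].
have deltaF phi x y : delta h l r phi x y = delta h l r (mem [set w in F | phi w]) x y.
  rewrite /delta; case hxy: (h x y) => //=; rewrite !inE.
  have [->|lr] := eqVneq (l x y) (r x y); first by rewrite !addbb.
  have F1 : l x y \in F.
    rewrite inE; apply/existsP; exists x; apply/existsP; exists y.
    by rewrite /delta hxy /= eqxx eq_sym (negPf lr).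
  have F2 : r x y \in F.
    rewrite inE; apply/existsP; exists x; apply/existsP; exists y.
    by rewrite /delta hxy /= eqxx (negPf lr).
  by move: F1 F2; rewrite !inE => -> ->.
have delta_sym phi : symmetric (delta h l r phi).
  by move=> x y; rewrite /delta h_sym ls rs.
have delta_sub phi : subrel (delta h l r phi) h by move=> x y /andP[].
(* Double counting: each face in [F] has at least four edges, and each edge lies on at most two
   faces. *)
have Ff : 4 * #|F| <= 2 * #|E|.
  rewrite mulnC -sum_nat_const.
  apply: (@leq_trans (\sum_(w in F) \sum_(a in E) delta h l r (pred1 w) a.1 a.2)).
    apply: leq_sum => w; rewrite inE => /existsP[x /existsP[y wxy]].
    have := even_card_ge4 (delta_sym _) (@delta_sub _) (dE _) wxy.
    move/leq_trans; apply; rewrite -sum1_card big_mkcond /=.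
    rewrite [X in _ <= X]big_mkcond /=; apply: leq_sum => a _.
    by rewrite inE; case: (a \in E) => //=; case: delta.
  rewrite exchange_big /= mulnC -sum_nat_const; apply: leq_sum => a _.
  apply: leq_trans (_ : #|[set l a.1 a.2; r a.1 a.2]| <= 2); last first.
    by rewrite cards2; case: eqP.
  rewrite -sum1_card big_mkcond [X in _ <= X]big_mkcond /=.
  apply: leq_sum => w _; case: ifP => // _; rewrite /delta !inE /=.
  by rewrite ![_ == w]eq_sym; do 2!case: eqP => //; case: (h _ _).
(* The handshake lemma determines the parity at the root [r0]; this saves one vertex in the
   exponent. *)
pose bd Q := [set x in D :\ r0 | boundary (zof Q) x].
pose rep c := odflt set0 [pick Q : {set U * U} | (Q \subset E) && (bd Q == c)].
have zof_sym Q : symmetric (zof Q) by move=> x y; rewrite /zof addbC.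
have /fin_all_exists[J JP] (Q : {set U * U}) : exists J : {set L}, Q \subset E -> bd Q = set0 ->
    J \subset F /\ zof Q =2 delta h l r (mem J).
  have [QE|QE] := boolP (Q \subset E); last by exists set0.
  have [bQ|bQ] := eqVneq (bd Q) set0; last by exists set0 => _ /eqP; rewrite (negPf bQ).
  have zsub := zof_sub QE.
  have b0 x : x != r0 -> boundary (zof Q) x = false.
    move=> xr0; have [xD|xD] := boolP (x \in D).
      by apply/negP => bx; have := in_set0 x; rewrite -bQ !inE xr0 xD bx.
    rewrite /boundary big1 // => y _; apply: contraNF xD => /zsub.
    exact: h_supp.
  have br0 : boundary (zof Q) r0 = false.
    have := handshake (zof_sym Q); rewrite (bigD1 r0) //= => <-.
      by rewrite big1 ?addbF.
    by move=> x; apply/negP => /zsub; rewrite bipartite_irr.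
  have [x|phi phiP] := dS _ (zof_sym Q) zsub.
    by have [->|/b0] := eqVneq x r0.
  exists [set w in F | phi w] => _ _; split.
    by apply/subsetP => w; rewrite inE => /andP[].
  by move=> x y; rewrite phiP deltaF.
(* [Q] differs from the representative with the same boundary by an even set, which a face set
   encodes; so boundary and face set together determine [Q]. *)
pose f Q := (bd Q, J (symdiff Q (rep (bd Q)))).
have repP (Q : {set U * U}) : Q \subset E -> (rep (bd Q) \subset E) && (bd (rep (bd Q)) == bd Q).
  by move=> QE; rewrite /rep; case: pickP => //= /(_ Q); rewrite QE eqxx.
have bdD Q R : bd Q = bd R -> bd (symdiff Q R) = set0.
  move=> QR; apply/setP => x; rewrite !inE.
  have -> : boundary (zof (symdiff Q R)) x = boundary (zof Q) x (+) boundary (zof R) x.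
    by rewrite -boundary_xor; apply: eq_boundary => y; apply: zof_symdiff.
  have : (x \in bd Q) = (x \in bd R) by rewrite QR.
  by rewrite !inE; case: (x != r0); case: (x \in D) => //= ->; apply: addbb.
have f_inj : {in powerset E &, injective f}.
  move=> Q1 Q2; rewrite !powersetE => Q1E Q2E [bdQ].
  have /andP[RE /eqP Rb] := repP _ Q2E.
  rewrite bdQ => JE; set R := rep _ in RE Rb JE.
  have [_ z1] := JP _ (symdiff_sub Q1E RE) (bdD _ _ (etrans bdQ (esym Rb))).
  have [_ z2] := JP _ (symdiff_sub Q2E RE) (bdD _ _ (esym Rb)).
  have zz x y : zof Q1 x y = zof Q2 x y.
    have := z1 x y; rewrite JE -z2 !zof_symdiff.
    by case: (zof R x y); case: (zof Q1 x y); case: (zof Q2 x y).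
  apply/setP => -[x y]; have [xyE|xyE] := boolP ((x, y) \in E).
    by rewrite -(zofE Q1E xyE) -(zofE Q2E xyE) zz.
  by apply/idP/idP => [/(subsetP Q1E)|/(subsetP Q2E)]; rewrite (negPf xyE).
have : 2 ^ #|E| <= 2 ^ (#|D|.-1 + #|F|).
  rewrite -card_powerset -(card_in_imset f_inj) expnD.
  have -> : #|D|.-1 = #|D :\ r0| by rewrite (cardsD1 r0 D) r0D.
  rewrite -!card_powerset -cardsX; apply/subset_leq_card/subsetP => _ /imsetP[Q + ->].
  rewrite powersetE => QE; rewrite inE /= !powersetE; apply/andP; split.
    by apply/subsetP => x; rewrite inE => /andP[].
  have /andP[RE /eqP Rb] := repP _ QE.
  by have [] := JP _ (symdiff_sub QE RE) (bdD _ _ (esym Rb)).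
rewrite leq_exp2l // => EDF.
have : 0 < #|D| by rewrite card_gt0; apply/set0Pn; exists r0.
(* With [n + 1] vertices, [m <= n + f] and [2 f <= m] give [m <= 2 n]. *)
move: EDF Ff; case: #|D| => // n; rewrite /= => EDF Ff _.
have : 2 * #|E| <= 2 * n + #|E|.
  rewrite (leq_trans (_ : _ <= 2 * (n + #|F|))) ?leq_mul2l //.
  by rewrite mulnDr leq_add2l -(leq_pmul2l (isT : 0 < 2)) mulnA.
by rewrite mul2n -addnn leq_add2r mulnS addnC leq_add2l.
Qed.

End Sparsity.

(** * Orientations with prescribed parities *)

(** Otherwise the component of [a] would contain exactly one vertex of odd degree, against the
    handshake lemma. *)
Lemma boundary_connect (T : finType) (z : rel T) a b :
  symmetric z -> irreflexive z ->
  (forall v, boundary z v = (v == a) (+) (v == b)) -> connect z a b.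
Proof.
move=> zs zi zb; apply: contraTT isT => nab.
pose X := [pred v | connect z a v].
have : \xor_(v | X v) boundary z v = true.
  rewrite (bigD1 a) /= ?connect0 // zb eqxx big1.
    by have -> : (a == b) = false by apply: contraNF nab => /eqP <-.
  move=> v /andP[av /negPf va]; rewrite zb va /=.
  by apply: contraNF nab => /eqP <-.
have -> : \xor_(v | X v) boundary z v = \xor_(v | X v) \xor_(y | X y) z v y.
  apply: eq_bigr => v av; rewrite /boundary (bigID X) /= [X in _ (+) X]big1 ?addbF //.
  move=> y; apply: contraNF => zvy; exact: connect_trans av (connect1 zvy).
by rewrite xor_sym.
Qed.

(** * Cycles in multigraphs *)

Section Multigraph.
Variables (N E : finType) (s t : E -> N) (A : {set E}) (X : {set N}).

(** Pigeonhole: [A] has more subsets than there are parity vectors on [X], and two subsets with the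
    same vector have an even symmetric difference. A loop contributes nothing to the parities. *)
Lemma even_arcs_exist : {in A, forall a, (s a \in X) && (t a \in X)} ->
  #|X| < #|A| -> exists Q : {set E}, [/\ Q \subset A, Q != set0 &
    forall n, \xor_(a | a \in Q) ((n == s a) (+) (n == t a)) = false].
Proof.
move=> AX XA.
pose f (Q : {set E}) := [set n in X | \xor_(a | a \in Q) ((n == s a) (+) (n == t a))].
have /dinjectivePn[Q1 Q1A [Q2 /andP[/= Q21 Q2A] fQ]] : ~~ dinjectiveb f (powerset A).
  apply/negP => /dinjectiveP f_inj; have := card_in_imset f_inj.
  rewrite card_powerset => cf.
  have : f @: powerset A \subset powerset X.
    apply/subsetP => _ /imsetP[Q _ ->]; rewrite powersetE.
    by apply/subsetP => n; rewrite inE => /andP[].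
  by move/subset_leq_card; rewrite cf card_powerset leq_exp2l // leqNgt XA.
rewrite !powersetE in Q1A Q2A.
have DA : [set a | (a \in Q1) (+) (a \in Q2)] \subset A.
  apply/subsetP => a; rewrite inE; case: (boolP (a \in Q1)) => [/(subsetP Q1A)//|_ /=].
  exact: (subsetP Q2A).
exists [set a | (a \in Q1) (+) (a \in Q2)]; split=> //.
  apply: contraNneq Q21 => Q0; apply/eqP/setP => a; have := in_set0 a.
  by rewrite -Q0 inE; case: (a \in Q1); case: (a \in Q2).
move=> n; have [nX|nX] := boolP (n \in X); last first.
  rewrite big1 // => a /(subsetP DA)/AX/andP[sX tX].
  have -> : (n == s a) = false by apply: contraNF nX => /eqP->.
  by have -> : (n == t a) = false by apply: contraNF nX => /eqP->.
have : (n \in f Q1) = (n \in f Q2) by rewrite fQ.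
rewrite !inE nX /= !(big_mkcond (fun a => a \in _)) /= => fn.
transitivity ((\big[addb/false]_a (if a \in Q1 then (n == s a) (+) (n == t a) else false))
  (+) (\big[addb/false]_a (if a \in Q2 then (n == s a) (+) (n == t a) else false))).
  rewrite -big_split; apply: eq_bigr => a _; rewrite inE /=.
  by case: (a \in Q1); case: (a \in Q2); rewrite /= ?addbF ?addbb.
by rewrite fn addbb.
Qed.

(** Parallel arcs stay distinct elements of [E], so deleting one of them keeps the adjacency that
    another realises. *)
Definition arc_adj (A' : {set E}) : rel N := fun n n' =>
  [exists a in A', ((s a == n) && (t a == n')) || ((s a == n') && (t a == n))].

Lemma arc_adj_sym A' : symmetric (arc_adj A').
Proof. by move=> n n'; apply: eq_existsb => a; rewrite orbC. Qed.

(** When an arc is removed from a nonempty even set, the rest has the same boundary as that arc and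
    therefore connects its ends. *)
Lemma closing_arc : {in A, forall a, (s a \in X) && (t a \in X)} -> #|X| < #|A| ->
  exists2 a, a \in A & connect (arc_adj (A :\ a)) (s a) (t a).
Proof.
move=> AX /(even_arcs_exist AX)[Q [QA /set0Pn[a0 a0Q] Qe]].
exists a0; first exact: (subsetP QA).
pose z n n' := \xor_(a | a \in Q :\ a0) edge (s a) (t a) n n'.
have zE n n' : z n n' -> arc_adj (A :\ a0) n n'.
  apply: contraTT => /exists_inPn nA; rewrite /z big1 // => a; rewrite !inE => /andP[aa0 aQ].
  have := nA a; rewrite !inE aa0 (subsetP QA) // => /(_ isT) /norP[na1 na2].
  apply/negbTE/negP => /edgeP[] [E1 E2]; subst n n'.
    by rewrite !eqxx in na1.
  by rewrite !eqxx in na2.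
suff: connect z (s a0) (t a0) by apply: connect_sub => n n' zz; apply/connect1/zE.
apply: boundary_connect => [n n'|n|v].
- by apply: eq_bigr => a _; apply: edge_sym.
- by rewrite /z big1 // => a _; rewrite /edge andbC addbb.
- rewrite /boundary exchange_big /=.
  have := Qe v; rewrite (bigD1 a0) //= => Q0.
  transitivity (\xor_(a | (a \in Q) && (a != a0)) ((v == s a) (+) (v == t a))).
    by apply: eq_big => [a|a _]; [rewrite !inE andbC|apply: boundary_edge].
  by apply: (@addbI ((v == s a0) (+) (v == t a0))); rewrite addbb.
Qed.

End Multigraph.

(** * Reversing edges of an orientation *)

Section Flip.
Variables (T : finType) (g : rel T).
Hypotheses (g_sym : symmetric g) (g_irr : irreflexive g).
Implicit Types (o P : rel T) (v w k : T).

(** When [o] orients [g] and [P] is a symmetric part of [g], exclusive or reverses exactly the edges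
    of [P]. *)
Definition flip o P : rel T := fun x y => o x y (+) P x y.

Lemma eq_indegree o o' v : (forall x, o x v = o' x v) -> indegree o v = indegree o' v.
Proof. by move=> oo'; apply: eq_card => x; rewrite !inE. Qed.

Lemma flip_orientation o P : orientation g o -> symmetric P -> subrel P g ->
  orientation g (flip o P).
Proof.
move=> [og oo] Ps Pg; split=> [x y|x y gxy].
  by rewrite /flip; case oxy: (o x y) => /=; [move=> _; exact: og|exact: Pg].
by rewrite /flip (Ps y x) addbACA addbb addbF oo.
Qed.

Lemma odd_indegree_flip o P v : symmetric P ->
  odd (indegree (flip o P) v) = odd (indegree o v) (+) boundary P v.
Proof.
move=> Ps; rewrite /indegree !xor_card /boundary -big_split /=.
by apply: eq_bigr => x _; rewrite /flip (Ps v).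
Qed.

Lemma indegree_flip_edge o k w v : v != k -> v != w ->
  indegree (flip o (edge k w)) v = indegree o v.
Proof.
move=> vk vw; apply: eq_indegree => x; rewrite /flip /edge.
by rewrite (negPf vk) (negPf vw) !andbF !addbF.
Qed.

Lemma indegree_flip_head o k w : k != w ->
  indegree (flip o (edge k w)) w + 2 * o k w = (indegree o w).+1.
Proof.
move=> kw; have fE x : flip o (edge k w) x w = o x w (+) (x == k).
  by rewrite /flip /edge eqxx andbT [w == k]eq_sym (negPf kw) andbF addbF.
rewrite /indegree (cardD1 k) [in RHS](cardD1 k) !inE fE eqxx.
rewrite [#|_|](@eq_card _ _ [predD1 [pred x | o x w] & k]); last first.
  by move=> x; rewrite !inE fE; case: eqP => //=; rewrite addbF.
by case: (o k w); rewrite /= ?muln1 ?muln0 ?addn0 ?addn2 add0n add1n.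
Qed.

End Flip.

Lemma path_restrict (N : finType) (e : rel N) (c : {set N}) x p :
  path e x p -> {subset x :: p <= c} ->
  path [rel m m' | [&& e m m', m \in c & m' \in c]] x p.
Proof.
elim: p x => //= m p IH x /andP[-> mp] sc.
rewrite !sc ?IH ?inE ?eqxx ?orbT // => n np; apply: sc.
by rewrite inE np orbT.
Qed.

(** * Flexible vertex sets and how they merge *)

Section Flexible.
Variables (T : finType) (g : rel T) (D : {set T}) (o : rel T).
Hypotheses (g_sym : symmetric g) (g_irr : irreflexive g).
Hypothesis g_supp : forall x y, g x y -> x \in D.
Hypothesis o_or : orientation g o.
Implicit Types (P : rel T) (nu : T -> T) (v w : T).

(** As long as indegrees stay at most [cap], no vertex gains excess over 6. *)
Let cap v := maxn 6 (indegree o v).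

Let cap_ge v : indegree o v <= cap v. Proof. exact: leq_maxr. Qed.

(* Flipping [P] corrects the parity defects at [a] and [b], and leaves room at
   both ends for one more incoming arc. *)
Definition flexible (B : {set T}) : Prop := {in B &, forall a b, exists P,
  [/\ symmetric P, forall x y, P x y -> [&& g x y, x \in B & y \in B],
      forall v, boundary P v = (v == a) (+) (v == b) &
      {in B, forall v, indegree (flip o P) v + (v == a) + (v == b) <= cap v}]}.

Lemma flexible_connected (B : {set T}) : flexible B ->
  {in B &, forall x y, connect [rel a b | [&& g a b, a \in B & b \in B]] x y}.
Proof.
move=> fB x y xB yB; have [P [Ps Pg Pb _]] := fB x y xB yB.
suff : connect P x y by apply: connect_sub => c d Pcd; apply/connect1/Pg.
apply: boundary_connect => // a; apply/negP => /Pg.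
by rewrite g_irr.
Qed.

Let fiber nu n := [set v in D | nu v == n].

(** [nu] labels the blocks of a partition of [D]; a block that is not yet flexible is a single
    vertex. *)
Definition flexible_partition nu :=
  forall v, v \in D -> flexible (fiber nu (nu v)) \/ fiber nu (nu v) = [set v].

(** Both defects fall on [v], so nothing is reversed and room for two arcs is required:
    [4 + 2 = 6]. *)
Lemma flexible_set1 v : indegree o v <= 4 -> flexible [set v].
Proof.
move=> v4 a b /set1P-> /set1P->; exists (fun _ _ => false); split=> // [w|w /set1P->].
  by rewrite /boundary big1 // addbb.
rewrite !eqxx; apply: leq_trans (_ : 6 <= _); last exact: leq_maxl.
have -> : indegree (flip o (fun _ _ => false)) v = indegree o v.
  by apply: eq_indegree => x; rewrite /flip addbF.
by rewrite !addn1 !ltnS.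
Qed.

Section Partition.
Variable nu : T -> T.
Hypothesis nu_part : flexible_partition nu.

Definition rigid := [set w in D | ~~ `[< flexible (fiber nu (nu w)) >]].
Let W := rigid.

Lemma rigid_fiber w v : w \in W -> v \in D -> nu v = nu w -> v = w.
Proof.
rewrite inE => /andP[wD /asboolP nf] vD vw; case: (nu_part wD) => // E.
by apply/set1P; rewrite -E inE vD vw eqxx.
Qed.

Lemma nonrigid_flexible v : v \in D -> v \notin W -> flexible (fiber nu (nu v)).
Proof. by move=> vD; rewrite inE vD negbK => /asboolP. Qed.

Lemma rigid_indegree w : w \in W -> 4 < indegree o w.
Proof.
rewrite inE => /andP[wD /asboolP nf]; rewrite ltnNge; apply/negP => w4.
by case: (nu_part wD) => // E; apply: nf; rewrite E; apply: flexible_set1.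
Qed.

Lemma rigid_D w : w \in W -> w \in D. Proof. by rewrite inE => /andP[]. Qed.

(** An edge at a rigid vertex points into it, so reversing that edge lowers the indegree there. *)
Definition usable (A' : {set T * T}) := {in A', forall a,
  [/\ g a.1 a.2, a.1 \notin W & a.2 \in W -> o a.1 a.2]}.

(* For a path from [a] to [b]: a rigid vertex inside the path loses two incoming
   arcs, and a rigid end loses one. *)
Let bound (o' : rel T) a b v :=
  indegree o' v + (if v \in W then 2 else (v == a) + (v == b))
  <= cap v + (if v \in W then (v == a) + (v == b) else 0).

(** Continuing the path along [st] settles the defect at [s]: the reversal uses up the room for one
    arc at a non-rigid [s], and removes an incoming arc from a rigid [s]. *)
Lemma bound_edge (o' : rel T) a s t v : s != t -> v != t -> (s \in W -> o' t s) ->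
  bound o' a s v ->
  indegree (flip o' (edge s t)) v + (if v \in W then 2 else nat_of_bool (v == a))
  <= cap v + (if v \in W then nat_of_bool (v == a) else 0).
Proof.
move=> st vt sW; rewrite /bound; have [->|vs] := eqVneq v s.
  have -> : indegree (flip o' (edge s t)) s = indegree (flip o' (edge t s)) s.
    by apply: eq_indegree => x; rewrite /flip edgeC.
  have := indegree_flip_head o' (_ : t != s); rewrite eq_sym => /(_ st).
  by case: (s \in W) sW => [->//|_]; case: (o' t s); case: (s == a); lia.
by rewrite indegree_flip_edge //; case: (v \in W); case: (v == a); lia.
Qed.

Lemma indegree_flip_out P v : symmetric P -> (forall x, P v x = false) ->
  indegree (flip o P) v = indegree o v.
Proof. by move=> Ps Pv; apply: eq_indegree => x; rewrite /flip Ps Pv addbF. Qed.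

Lemma fiber_join n : {in fiber nu n &, forall a b, exists P,
  [/\ symmetric P, forall x y, P x y -> [&& g x y, nu x == n & nu y == n],
      forall v, boundary P v = (v == a) (+) (v == b) &
      {in fiber nu n, forall v, bound (flip o P) a b v}]}.
Proof.
move=> a b; rewrite !inE => /andP[aD /eqP an] /andP[bD /eqP bn].
have [aW|aW] := boolP (a \in W).
  have -> : b = a by apply: rigid_fiber => //; rewrite an bn.
  exists (fun _ _ => false); split=> // [v|v].
    by rewrite /boundary big1 // addbb.
  rewrite inE => /andP[vD /eqP vn].
  have -> : v = a by apply: rigid_fiber => //; rewrite vn an.
  by rewrite /bound indegree_flip_out // aW eqxx leq_add2r cap_ge.
have fF := nonrigid_flexible aD aW; rewrite an in fF.
have [||P [Ps Pg Pb Pi]] := fF a b; rewrite ?inE ?aD ?bD ?an ?bn ?eqxx //.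
exists P; split=> // [x y /Pg/and3P[-> ]|v vF].
  by rewrite !inE => /andP[_ ->] /andP[_ ->].
have vW : v \notin W.
  apply: contra aW => vW; have : a = v.
    by apply: rigid_fiber => //; move: vF; rewrite inE an => /andP[_ /eqP].
  by move->.
by rewrite /bound (negPf vW) addnA addn0; apply: Pi.
Qed.

(** The path of blocks is realised by a join inside each block, from where it is entered to where it
    is left, and one usable edge between consecutive blocks. Each block is visited once, so the
    joins do not interfere; a rigid vertex inside the path loses both edges at which it is entered
    and left. *)
Lemma path_join (A' : {set T * T}) n p a b : usable A' ->
  uniq (n :: p) -> path (arc_adj (nu \o fst) (nu \o snd) A') n p ->
  a \in fiber nu n -> b \in fiber nu (last n p) -> exists P,
  [/\ symmetric P,
      forall x y, P x y -> [&& g x y, nu x \in n :: p, nu y \in n :: p &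
                            [|| (x, y) \in A', (y, x) \in A' | nu x == nu y]],
      forall v, boundary P v = (v == a) (+) (v == b) &
      forall v, v \in D -> nu v \in n :: p -> bound (flip o P) a b v].
Proof.
move=> A'u; elim: p n a => [|n1 p IH] n a.
  move=> _ _ /= aF bF; have [P [Ps Pg Pb Pi]] := fiber_join aF bF.
  exists P; split=> // [x y /Pg/and3P[-> /eqP-> /eqP->]|v vD].
    by rewrite inE !eqxx !orbT.
  by rewrite inE => vn; apply: Pi; rewrite inE vD.
move=> /= /andP[nN /[dup] /andP[n1N _] up] /andP[nn1 pp] aF bF.
(* The edge [st] realises the first step; it points towards a rigid end. *)
have [s [t [sF tF gst [sW tW stA]]]] : exists s t,
    [/\ s \in fiber nu n, t \in fiber nu n1, g s t &
     [/\ s \in W -> o t s, t \in W -> o s t & ((s, t) \in A') || ((t, s) \in A')]].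
  have /exists_inP[[x y] xyA /= E] := nn1.
  have [/= gxy xW yW] := A'u _ xyA; have gyx : g y x by rewrite g_sym.
  case/orP: E => /andP[/eqP xE /eqP yE].
    exists x, y; rewrite ![_ \in fiber _ _]inE xE yE !eqxx (g_supp gxy) (g_supp gyx); split=> //.
    by split=> //; [rewrite (negPf xW)|rewrite xyA].
  exists y, x; rewrite ![_ \in fiber _ _]inE xE yE !eqxx (g_supp gxy) (g_supp gyx); split=> //.
  by split=> //; [rewrite (negPf xW)|rewrite xyA orbT].
have sn : nu s = n by move: sF; rewrite inE => /andP[_ /eqP].
have tn : nu t = n1 by move: tF; rewrite inE => /andP[_ /eqP].
have st : s != t by apply: contraNneq nN => E; rewrite -sn E tn mem_head.
have [P0 [P0s P0g P0b P0i]] := fiber_join aF sF.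
have [P1 [P1s P1g P1b P1i]] := IH n1 t up pp tF bF.
have P0out v x : nu v != n -> P0 v x = false.
  by move=> vn; apply: contraNF vn => /P0g/and3P[].
have P1out v x : nu v \notin n1 :: p -> P1 v x = false.
  by move=> vn; apply: contraNF vn => /P1g/and4P[].
exists (fun x y => (P0 x y (+) P1 x y) (+) edge s t x y); split.
- by move=> x y; rewrite edge_sym P0s P1s.
- move=> x y; case P0xy: (P0 x y).
    have /and3P[-> /eqP-> /eqP->] := P0g _ _ P0xy.
    by rewrite !mem_head eqxx !orbT.
  case P1xy: (P1 x y).
    have /and4P[-> xp yp xyA] := P1g _ _ P1xy.
    by rewrite (mem_behead (s := n :: n1 :: p) xp) (mem_behead (s := n :: n1 :: p) yp) xyA.
  move=> /edgeP[] [-> ->]; rewrite sn tn !inE !eqxx !orbT /=.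
    by rewrite gst; case/orP: stA => ->; rewrite ?orbT.
  by rewrite g_sym gst; case/orP: stA => ->; rewrite ?orbT.
- move=> v; transitivity (boundary P0 v (+) boundary P1 v (+) boundary (edge s t) v).
    by rewrite -!boundary_xor.
  rewrite P0b P1b boundary_edge.
  by case: (v == a); case: (v == s); case: (v == t); case: (v == b).
move=> v vD; rewrite inE; have [vn _|vn /= vp] := eqVneq (nu v) n.
  have vt : v != t by apply: contraNneq nN => vt; rewrite -vn vt tn mem_head.
  have vb : v != b.
    apply: contraNneq nN => vb; rewrite -vn vb; move: bF; rewrite inE => /andP[_ /eqP->].
    exact: mem_last.
  have vF : v \in fiber nu n by rewrite inE vD vn eqxx.
  have -> : bound (flip o (fun x y => (P0 x y (+) P1 x y) (+) edge s t x y)) a b v =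
    (indegree (flip (flip o P0) (edge s t)) v + (if v \in W then 2 else nat_of_bool (v == a))
    <= cap v + (if v \in W then nat_of_bool (v == a) else 0)).
    rewrite /bound (negPf vb) !addn0; congr (_ + _ <= _).
    by apply: eq_indegree => x; rewrite /flip (P1s x) P1out ?vn // addbF addbA.
  apply: bound_edge => //; last exact: P0i.
  move=> /sW ots; rewrite /flip ots P0s; case P0st: (P0 s t) => //.
  by move/P0g: P0st => /and3P[_ _]; rewrite tn => /eqP n1n; rewrite -n1n mem_head in nN.
have vs : v != s by apply: contraNneq vn => ->; rewrite sn.
have va : v != a.
  by apply: contraNneq vn => ->; move: aF; rewrite inE => /andP[].
have -> : bound (flip o (fun x y => (P0 x y (+) P1 x y) (+) edge s t x y)) a b v =
    (indegree (flip (flip o P1) (edge t s)) v + (if v \in W then 2 else nat_of_bool (v == b))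
    <= cap v + (if v \in W then nat_of_bool (v == b) else 0)).
  rewrite /bound (negPf va) !add0n; congr (_ + _ <= _).
  by apply: eq_indegree => x; rewrite /flip (P0s x) P0out // addFb addbA edgeC.
apply: bound_edge; rewrite 1?eq_sym // 1?eq_sym //.
  move=> /tW ost; rewrite /flip ost; case P1st: (P1 s t) => //.
  by move/P1g: P1st => /and4P[_]; rewrite sn (negPf nN).
by have := P1i v vD vp; rewrite /bound ![_ + (v == b)]addnC.
Qed.


(** Defects in different blocks are corrected along a path of blocks, and defects in one flexible
    block inside it. If both fall on one rigid vertex, the last hypothesis supplies an even set
    whose reversal leaves room for two arcs there. *)
Lemma flexible_union (A' : {set T * T}) (c : {set T}) : usable A' ->
  {in c &, forall n n', connect
     [rel m m' | [&& arc_adj (nu \o fst) (nu \o snd) A' m m', m \in c & m' \in c]] n n'} ->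
  (forall w, w \in W -> nu w \in c -> exists Q,
     [/\ symmetric Q, forall x y, Q x y -> [&& g x y, nu x \in c & nu y \in c],
         forall v, boundary Q v = false &
         forall v, v \in D -> nu v \in c ->
           indegree (flip o Q) v + (if v \in W then 2 else 0) <= cap v]) ->
  flexible [set v in D | nu v \in c].
Proof.
move=> A'u cc cyc a b; rewrite !inE => /andP[aD ac] /andP[bD bc].
have inU x y : g x y -> nu x \in c -> nu y \in c ->
    [&& g x y, x \in [set v in D | nu v \in c] & y \in [set v in D | nu v \in c]].
  by move=> gxy xc yc; rewrite gxy !inE (g_supp gxy) (g_supp (_ : g y x)) ?xc ?yc // g_sym.
have [ab|ab] := eqVneq (nu a) (nu b).
  have [aW|aW] := boolP (a \in W).
    have [Q [Qs Qg Qb Qi]] := cyc a aW ac.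
    have -> : b = a by apply: rigid_fiber.
    exists Q; split=> // [x y /Qg/and3P[]|v|v]; first exact: inU.
      by rewrite Qb addbb.
    rewrite inE => /andP[vD vc]; have := Qi v vD vc.
    have [->|_] := eqVneq v a; first by rewrite aW -addnA.
    by rewrite !addn0; apply: leq_trans; rewrite leq_addr.
  have [||P [Ps Pg Pb Pi]] := nonrigid_flexible aD aW (_ : a \in _) (_ : b \in _).
  - by rewrite inE aD eqxx.
  - by rewrite inE bD ab eqxx.
  exists P; split=> // [x y /Pg/and3P[gxy xF yF]|v].
    by apply: inU => //; [move: xF|move: yF]; rewrite inE => /andP[_ /eqP->].
  rewrite inE => /andP[vD vc]; have [va|va] := eqVneq (nu v) (nu a).
    by apply: Pi; rewrite inE vD va eqxx.
  rewrite indegree_flip_out //; last first.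
    by move=> x; apply: contraNF va => /Pg/and3P[_]; rewrite inE => /andP[].
  have -> : (v == a) = false by apply: contraNF va => /eqP->.
  have -> : (v == b) = false by apply: contraNF va => /eqP->; rewrite ab.
  by rewrite !addn0 cap_ge.
have /connectP[q qp bq] := cc _ _ ac bc.
case/shortenP: qp bq => p pp up _ bp.
have pc : {subset nu a :: p <= c}.
  move=> n; rewrite inE => /predU1P[->//|].
  elim: {up bp} p (nu a) pp => //= m p IH m' /andP[/and3P[_ _ mc] mp].
  by rewrite inE => /predU1P[->//|]; apply: IH mp.
have pp' : path (arc_adj (nu \o fst) (nu \o snd) A') (nu a) p.
  by apply: sub_path pp => m m' /and3P[].
have [||P [Ps Pg Pb Pi]] := path_join A'u up pp' (_ : a \in _) (_ : b \in _).
- by rewrite inE aD eqxx.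
- by rewrite inE bD bp eqxx.
exists P; split=> // [x y /Pg/and4P[gxy xp yp _]|v].
  by apply: inU; rewrite ?pc.
rewrite inE => /andP[vD vc]; have ab' : a != b by apply: contraNneq ab => ->.
have vab : (v == a) + (v == b) <= 1.
  by case: (eqVneq v a) => [->|]; rewrite ?(negPf ab') //; case: (v == b).
have [vp|vp] := boolP (nu v \in nu a :: p).
  have := Pi v vD vp; move: vab; rewrite /bound; move: (cap v) (indegree _ v) => C I.
  by case: (v \in W); case: (v == a); case: (v == b); clear; lia.
rewrite indegree_flip_out //; last first.
  by move=> x; apply: contraNF vp => /Pg/and4P[].
have -> : (v == a) = false by apply: contraNF vp => /eqP->; rewrite mem_head.
have -> : (v == b) = false by apply: contraNF vp => /eqP->; rewrite bp mem_last.
by rewrite !addn0 cap_ge.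
Qed.

Lemma merge_partition (c : {set T}) : c \subset nu @: D -> 1 < #|c| ->
  flexible [set v in D | nu v \in c] ->
  exists nu', flexible_partition nu' /\ #|nu' @: D| < #|nu @: D|.
Proof.
move=> cD c1 fc; have /set0Pn[r rc] : c != set0 by rewrite -card_gt0 ltnW.
(* The merged block reuses a label from [c], which no block outside [c] bears. *)
pose nu' v := if nu v \in c then r else nu v.
exists nu'; split.
  move=> v vD; rewrite /nu'; case: ifP => vc.
    left; congr flexible: fc; apply/setP => x; rewrite !inE; congr (_ && _).
    case: ifP => xc; first by rewrite eqxx.
    by apply/esym/negbTE; apply: contraFneq xc => ->.
  have -> : fiber (fun v => if nu v \in c then r else nu v) (nu v) = fiber nu (nu v).
    apply/setP => x; rewrite !inE; congr (_ && _); case: ifP => // xc.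
    have -> : (r == nu v) = false by apply: contraFF vc => /eqP<-.
    by apply/esym/negbTE; apply: contraFneq vc => <-.
  exact: nu_part.
have : nu' @: D \subset r |: (nu @: D :\: c).
  apply/subsetP => _ /imsetP[v vD ->]; rewrite /nu' !inE.
  by case: ifP => [|vc]; rewrite ?eqxx // vc imset_f ?orbT.
move/subset_leq_card/leq_ltn_trans; apply; rewrite cardsU1 !inE rc /=.
have := subset_leq_card cD; rewrite cardsD (setIidPr cD); lia.
Qed.

Lemma merge_nonrigid x y : g x y -> x \notin W -> y \notin W -> nu x != nu y ->
  exists nu', flexible_partition nu' /\ #|nu' @: D| < #|nu @: D|.
Proof.
move=> gxy xW yW xy; have xD := g_supp gxy.
have yD : y \in D by apply: (@g_supp _ x); rewrite g_sym.
apply: (@merge_partition [set nu x; nu y]).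
- by apply/subsetP => n /set2P[]->; apply: imset_f.
- by rewrite cards2 xy.
apply: (@flexible_union [set (x, y)]).
- by move=> _ /set1P->; rewrite (negPf yW).
- have adj : arc_adj (nu \o fst) (nu \o snd) [set (x, y)] (nu x) (nu y).
    by apply/exists_inP; exists (x, y); rewrite ?inE //= !eqxx.
  move=> _ _ /set2P[]-> /set2P[]->; rewrite ?connect0 //; apply: connect1 => /=.
    by rewrite adj !inE !eqxx orbT.
  by rewrite arc_adj_sym adj !inE !eqxx orbT.
- move=> w wW /set2P[] /esym E.
    by move: xW; rewrite (rigid_fiber wW xD E) wW.
  by move: yW; rewrite (rigid_fiber wW yD E) wW.
Qed.

(** Contracting the blocks turns the arcs from outside [W] into [W] into a multigraph with more arcs
    than nodes, so some arc [kw] closes a cycle. Both cycle arcs at a rigid vertex point into it;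
    reversing the cycle makes room for two arcs there, and the blocks on the cycle merge into a
    flexible one. *)
Lemma merge_cycle :
  #|nu @: D| < #|[set a | [&& o a.1 a.2, a.1 \notin W & a.2 \in W]]| ->
  exists nu', flexible_partition nu' /\ #|nu' @: D| < #|nu @: D|.
Proof.
set Ar := [set a | _] => lt_Ar; have [og _] := o_or.
have ArP a : a \in Ar -> [/\ g a.1 a.2, o a.1 a.2, a.1 \notin W & a.2 \in W].
  by rewrite inE => /and3P[oa -> ->]; split=> //; apply: og.
have [|[k w] kwAr conn] := @closing_arc _ _ (nu \o fst) (nu \o snd) Ar (nu @: D) _ lt_Ar.
  move=> a /ArP[ga _ _ aW] /=; rewrite !imset_f //; last exact: g_supp ga.
  exact: rigid_D.
rewrite /= in conn; have [/= gkw okw kW wW] := ArP _ kwAr.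
have kD := g_supp gkw; have wD := rigid_D wW.
have kw : nu k != nu w.
  by apply: contraNneq kW => E; rewrite (rigid_fiber wW kD E).
have {conn}/connectP[q qp wq] := conn.
case/shortenP: qp wq => p pp up _ wp.
(* Leaving [(k, w)] out of [A'] ensures that [P] does not already reverse this arc. *)
pose A' := Ar :\ (k, w); pose c := [set n in nu k :: p].
have A'u : usable A'.
  by move=> a; rewrite inE => /andP[_ /ArP[]].
have [||P [Ps Pg Pb Pi]] := path_join A'u up pp (_ : k \in _) (_ : w \in _).
- by rewrite inE kD eqxx.
- by rewrite inE wD wp eqxx.
have kc : nu k \in c by rewrite inE mem_head.
have wc : nu w \in c by rewrite inE wp mem_last.
have knw : k != w by apply: contraNneq kw => ->.
have Pkw : P k w = false.
  apply/negP => /Pg/and4P[_ _ _]; rewrite (negPf kw) orbF => /orP[].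
    by rewrite !inE eqxx.
  by rewrite inE => /andP[_ /ArP[_ _]]; rewrite wW.
apply: (@merge_partition c).
- apply/subsetP => n; rewrite inE inE => /predU1P[->|np]; first exact: imset_f.
  have : exists2 m, m \in nu k :: p & arc_adj (nu \o fst) (nu \o snd) A' m n.
    elim: p (nu k) {up wp Pg Pi c kc wc} pp np => //= m p IH m' /andP[mm' mp].
    rewrite inE => /predU1P[->|np]; first by exists m'; rewrite ?mem_head.
    by have [m2 m2p m2n] := IH _ mp np; exists m2 => //; rewrite inE m2p orbT.
  move=> [m _ /exists_inP[a /setD1P[_ /ArP[ga _ _ aW]] /=]].
  by case/orP=> /andP[/eqP E1 /eqP E2]; rewrite -?E1 -?E2 imset_f // ?(g_supp ga) ?rigid_D.
- have : [set nu k; nu w] \subset c.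
    by apply/subsetP => n /set2P[]->.
  by move/subset_leq_card; rewrite cards2 kw.
apply: (@flexible_union A') => //.
  pose R := [rel m m' | [&& arc_adj (nu \o fst) (nu \o snd) A' m m', m \in c & m' \in c]].
  have Rs : connect_sym R.
    apply: sym_connect_sym => m m' /=; rewrite arc_adj_sym; congr (_ && _).
    exact: andbC.
  have Rp : path R (nu k) p.
    by apply: path_restrict pp _ => n np; rewrite in_set.
  have Rk n : n \in c -> connect R (nu k) n.
    by rewrite inE; apply: (path_connect Rp).
  move=> n n' nc n'c; apply: connect_trans (Rk _ n'c).
  by rewrite Rs Rk.
(* The join from [k] to [w] and the edge [kw] form an even set, which serves every rigid vertex on
   the cycle. *)
move=> w' w'W w'c; exists (fun x y => P x y (+) edge k w x y); split.
- by move=> x y; rewrite edge_sym Ps.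
- move=> x y; case Pxy: (P x y).
    by have /and4P[-> xp yp _] := Pg _ _ Pxy; rewrite !in_set xp yp.
  by rewrite addFb => /edgeP[] [-> ->]; rewrite ?kc ?wc ?gkw // g_sym gkw.
- move=> v; transitivity (boundary P v (+) boundary (edge k w) v).
    by rewrite -boundary_xor.
  by rewrite Pb boundary_edge addbb.
move=> v vD vc.
have -> : indegree (flip o (fun x y => P x y (+) edge k w x y)) v =
          indegree (flip (flip o P) (edge k w)) v.
  by apply: eq_indegree => x; rewrite /flip addbA.
have vp : nu v \in nu k :: p by rewrite inE in vc.
have {vp}Pi := Pi v vD vp; rewrite /bound in Pi.
(* At [w], an end of the path, reversing [kw] provides the second lost arc; at [k] the new incoming
   arc fills the room left by [path_join]. *)
have [vw|vw] := eqVneq v w.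
  have fkw : flip o P k w by rewrite /flip okw Pkw.
  have := indegree_flip_head (flip o P) knw; rewrite fkw.
  move: Pi; rewrite vw wW eqxx [w == k]eq_sym (negPf knw).
  by move: (cap w) (indegree _ w) (indegree _ w) => C I J; clear; lia.
have [vk|vk] := eqVneq v k; last first.
  rewrite indegree_flip_edge //; move: Pi; rewrite (negPf vk) (negPf vw).
  by move: (cap v) (indegree _ v) => C I; case: (v \in W); clear; lia.
have -> : indegree (flip (flip o P) (edge k w)) v = indegree (flip (flip o P) (edge w k)) v.
  by apply: eq_indegree => x; rewrite /flip edgeC.
have := indegree_flip_head (flip o P) (_ : w != k); rewrite eq_sym => /(_ knw).
move: Pi; rewrite vk (negPf kW) eqxx (negPf knw) !addn0.
move: (cap k) (indegree _ k) (indegree _ k) => C I J; case: (flip o P w k); clear; lia.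
Qed.

End Partition.
End Flexible.

Section Counting.
Variable T : finType.

Lemma card_pairs (s : rel T) : #|[set a | s a.1 a.2]| = \sum_x \sum_y s x y.
Proof.
rewrite pair_big /= -sum1_card big_mkcond; apply: eq_bigr => a _.
by rewrite inE; case: (s _ _).
Qed.

Lemma card_half_pairs (g s : rel T) : symmetric g ->
  (forall x y, s x y -> g x y) -> (forall x y, g x y -> s x y (+) s y x) ->
  #|[set a | g a.1 a.2]| = 2 * #|[set a | s a.1 a.2]|.
Proof.
move=> g_sym sg sx; rewrite !card_pairs mul2n -addnn.
rewrite [X in _ = _ + X]exchange_big -big_split; apply: eq_bigr => x _ /=.
rewrite -big_split; apply: eq_bigr => y _ /=.
have := sx x y; have := sg x y; have := sg y x; rewrite (g_sym y x).
by case: (g x y); case: (s x y); case: (s y x) => // h1 h2 h3;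
  [have := h3 isT|have := h3 isT|have := h2 isT|have := h2 isT|have := h1 isT].
Qed.

Lemma sum_indegree (o : rel T) (W : {set T}) :
  \sum_(w in W) indegree o w = #|[set a | o a.1 a.2 && (a.2 \in W)]|.
Proof.
rewrite (card_pairs (fun x y => o x y && (y \in W))) exchange_big [LHS]big_mkcond /=.
apply: eq_bigr => w _; rewrite /indegree -sum1_card big_mkcond /=.
case: (w \in W); last by rewrite big1 // => x _; rewrite andbF.
by apply: eq_bigr => x _; rewrite inE andbT; case: (o x w).
Qed.

End Counting.

(** The counting hypothesis is [e(W) + c < 4 |W|], doubled because pairs count each edge twice; [nu]
    labels the components outside [W]. *)
Theorem bounded_parity_orientation (T : finType) (g : rel T) (D : {set T}) (o0 : rel T) :
  symmetric g -> irreflexive g -> (forall x y, g x y -> x \in D) ->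
  orientation g o0 ->
  (forall (W : {set T}) (nu : T -> T), W \subset D -> W != set0 ->
    (forall n, {in [set v in D :\: W | nu v == n] &, forall x y,
       connect [rel a b | [&& g a b, a \in [set v in D :\: W | nu v == n] &
                           b \in [set v in D :\: W | nu v == n]]] x y}) ->
    (forall x y, g x y -> x \notin W -> y \notin W -> nu x = nu y) ->
    #|[set a | [&& g a.1 a.2, a.1 \in W & a.2 \in W]]| + 2 * #|nu @: (D :\: W)|
      < 8 * #|W|) ->
  exists o, [/\ orientation g o,
    forall v, odd (indegree o v) = odd (indegree o0 v) & forall v, indegree o v <= 6].
Proof.
move=> g_sym g_irr g_supp o0_or count.
(* The sum of [maxn 6] differs from the total excess over 6 by a constant. *)
have exP : exists n, `[< exists o, [/\ orientation g o,
    forall v, odd (indegree o v) = odd (indegree o0 v) &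
    \sum_v maxn 6 (indegree o v) = n] >].
  by exists (\sum_v maxn 6 (indegree o0 v)); apply/asboolP; exists o0.
have [n /asboolP[o [o_or o_odd <-]] o_min] := ex_minnP exP.
exists o; split=> // s; rewrite leqNgt; apply/negP => s6.
(* For this orientation a partition with the fewest blocks is taken; the singletons show that one
   exists. *)
have exQ : exists n, `[< exists nu, flexible_partition g D o nu /\ #|nu @: D| = n >].
  exists #|id @: D|; apply/asboolP; exists id; split=> // v vD; right.
  by apply/setP => x; rewrite !inE andbC; have [->|//] := eqVneq x v; rewrite vD.
have [m /asboolP[nu [nu_part <-]] nu_min] := ex_minnP exQ.
have nomerge : ~ exists nu', flexible_partition g D o nu' /\ #|nu' @: D| < #|nu @: D|.
  move=> [nu' [nu'_part]]; rewrite ltnNge => /negP; apply; apply: nu_min.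
  by apply/asboolP; exists nu'.
pose W := rigid g D o nu.
have W0 : W = set0.
  apply/eqP/negPn/negP => Wn0; apply: (nomerge).
  apply: merge_cycle => //; rewrite -/W.
  have WD : W \subset D by apply/subsetP => w; apply: rigid_D.
  (* The blocks outside [W] are flexible, hence connected, and by minimality no edge joins two of
     them: they are the components of [g] outside [W]. *)
  have c4 : #|[set a | [&& g a.1 a.2, a.1 \in W & a.2 \in W]]| +
      2 * #|nu @: (D :\: W)| < 8 * #|W|.
    apply: count => //.
  - move=> k x y xF yF; have xW : x \notin W.
      by move: xF; rewrite !inE => /andP[/andP[]].
    have xD : x \in D by move: xF; rewrite !inE => /andP[/andP[]].
    have xk : nu x = k by move: xF; rewrite inE => /andP[_ /eqP].
    have -> : [set v in D :\: W | nu v == k] = [set v in D | nu v == nu x].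
      apply/setP => v; rewrite inE in_setD [in RHS]inE xk.
      case: (boolP (v \in W)) => //= vW.
      apply/esym/negbTE; rewrite negb_and; have [vD /=|//] := boolP (v \in D).
      apply: contra xW => /eqP vk; rewrite (rigid_fiber nu_part vW xD) ?xk ?vk //.
    apply: flexible_connected => //; last first.
    + by move: yF; rewrite xk inE in_setD [in X in _ -> X]inE => /andP[/andP[_ ->]].
    + by rewrite in_set xD eqxx.
    exact: (nonrigid_flexible xD xW).
  - move=> x y gxy xW yW; apply/eqP/negPn/negP => xy; apply: (nomerge).
    exact: merge_nonrigid xy.
  set Ar := [set a | _].
  (* Rigid vertices have indegree at least 5, so at least [5 |W| - e(W) > |W| + c] arcs enter [W]
     from outside, more than there are blocks. *)
  have sumW : 5 * #|W| <= #|Ar| + #|[set a | [&& o a.1 a.2, a.1 \in W & a.2 \in W]]|.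
    rewrite mulnC -sum_nat_const.
    apply: (@leq_trans (\sum_(w in W) indegree o w)).
      by apply: leq_sum => w; apply: rigid_indegree.
    rewrite sum_indegree -(cardsID [set a | a.1 \in W]) addnC leq_add //.
      apply/subset_leq_card/subsetP => a; rewrite !in_set.
      by move=> /and3P[-> -> ->].
    apply/subset_leq_card/subsetP => a; rewrite !in_set.
    by move=> /andP[/andP[-> ->] ->].
  have half : #|[set a | [&& g a.1 a.2, a.1 \in W & a.2 \in W]]| =
      2 * #|[set a | [&& o a.1 a.2, a.1 \in W & a.2 \in W]]|.
    apply: (card_half_pairs (g := fun x y => [&& g x y, x \in W & y \in W])
      (s := fun x y => [&& o x y, x \in W & y \in W])).
    - by move=> x y; rewrite g_sym [(x \in W) && _]andbC.
    - by move=> x y /and3P[/(proj1 o_or) -> -> ->].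
    - by move=> x y /and3P[/(proj2 o_or) + -> ->]; rewrite !andbT.
  have nodes : #|nu @: D| <= #|W| + #|nu @: (D :\: W)|.
    have -> : nu @: D = nu @: W :|: nu @: (D :\: W).
      by rewrite -imsetU -{1}(setID D W) (setIidPr WD).
    apply: leq_trans (leq_card_setU _ _) _.
    by rewrite leq_add2r leq_imset_card.
  move: sumW half nodes c4; clear; lia.
have sD : s \in D.
  have : 0 < indegree o s by apply: leq_trans s6.
  rewrite /indegree => /card_gt0P[x]; rewrite inE => /(proj1 o_or).
  by rewrite g_sym => /g_supp.
have sW : s \notin W by rewrite W0 inE.
have sF : s \in [set v in D | nu v == nu s] by rewrite inE sD eqxx.
(* Two defects at [s] cancel, so all parities are kept, while the room for two arcs forces the
   indegree of [s] down by at least two. *)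
have [P [Ps Pg Pb Pi]] := nonrigid_flexible sD sW sF sF.
have := o_min (\sum_v maxn 6 (indegree (flip o P) v)).
have -> : `[< exists o', [/\ orientation g o',
    forall v, odd (indegree o' v) = odd (indegree o0 v) &
    \sum_v maxn 6 (indegree o' v) = \sum_v maxn 6 (indegree (flip o P) v)] >].
  apply/asboolP; exists (flip o P); split=> //.
    by apply: flip_orientation => // x y /Pg/and3P[].
  by move=> v; rewrite odd_indegree_flip // Pb addbb addbF.
move=> /(_ isT); apply/negP; rewrite -ltnNge.
have le v : maxn 6 (indegree (flip o P) v) <= maxn 6 (indegree o v).
  rewrite geq_max leq_maxl /=; have [vF|vF] := boolP (v \in [set v in D | nu v == nu s]).
    by apply: leq_trans (Pi v vF); rewrite -addnA leq_addr.
  rewrite indegree_flip_out ?leq_maxr // => x.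
  by apply: contraNF vF => /Pg/and3P[].
rewrite (bigD1 s) //= [X in _ < X](bigD1 s) //= -addSn leq_add ?leq_sum //.
have := Pi s sF; rewrite eqxx; move: s6; clear; lia.
Qed.

(** * Graphs with a dual *)

Lemma connect_stable (T : finType) (r : rel T) (X : pred T) x y :
  connect r x y -> (forall a b, r a b -> X a -> X b) -> X x -> X y.
Proof.
move=> /connectP[p rp ->] st; elim: p x rp => //= z p IH x /andP[xz zp] Xx.
by apply: IH => //; apply: st xz Xx.
Qed.

(** * The counting inequality for 3-connected bipartite graphs *)

Section PlanarCount.
Variables (T : finType) (e : rel T) (A : {set T}).
Hypotheses (e_sym : symmetric e) (e_irr : irreflexive e) (e_dual : has_dual e).
Hypothesis e_bip : forall x y, e x y -> (x \in A) != (y \in A).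

Lemma induced_sparse (W : {set T}) : W != set0 ->
  #|[set a | [&& e a.1 a.2, a.1 \in W & a.2 \in W]]| + 4 <= 4 * #|W|.
Proof.
move=> W0; pose h x y := [&& e x y, x \in W & y \in W].
have h_sym : symmetric h by move=> x y; rewrite /h e_sym [(x \in W) && _]andbC.
have h_dual : has_dual h.
  apply: (@minor_dual _ _ e h (fun x => [set x])) => //.
  - by move=> x; rewrite /h e_irr.
  - by move=> x y z /set1P-> /set1P.
  - by move=> u x y /set1P-> /set1P->; apply: connect0.
  - by move=> x y /and3P[exy _ _]; exists x, y; rewrite !inE.
have := @dual_sparse _ h A W h_sym _ _ h_dual W0.
rewrite (@card_half_pairs _ h (fun x y => h x y && (x \in A))) //.
- move=> /(_ _ _)-H; have {}H := H _ _; have -> : 4 * #|W| = 2 * (2 * #|W|) by rewrite mulnA.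
  rewrite -[4]/(2 * 2) -mulnDr leq_mul2l /=; apply: H.
    by move=> x y /and3P[/e_bip].
  by move=> x y /and3P[].
- by move=> x y /andP[].
- move=> x y /[dup] hxy /and3P[/e_bip exy _ _]; rewrite (h_sym y x) hxy /=.
  by case: (x \in A) exy; case: (y \in A).
Qed.

Hypothesis e_3conn : k_connected e 3.

Section Components.
Variables (W : {set T}) (nu : T -> T).
Hypothesis nu_conn : forall n, {in [set v in ~: W | nu v == n] &, forall x y,
  connect [rel a b | [&& e a b, a \in [set v in ~: W | nu v == n] &
                      b \in [set v in ~: W | nu v == n]]] x y}.
Hypothesis nu_sep : forall x y, e x y -> x \notin W -> y \notin W -> nu x = nu y.

Let c := #|nu @: (~: W)|.

Lemma components_le1 : #|W| <= 2 -> c <= 1.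
Proof.
move=> W2; apply/card_le1_eqP => _ _ /imsetP[x + ->] /imsetP[y + ->].
rewrite !inE => xW yW; apply/eqP.
have := connect_stable (X := fun y => nu y == nu x) (e_3conn.2 W W2 x y xW yW).
move=> /= H; apply: H; rewrite ?eqxx // => a b /and3P[eab aW bW] /eqP <-.
by rewrite (nu_sep eab aW bW).
Qed.

Let nbr n w := [&& w \in W & [exists k, [&& k \notin W, nu k == n & e k w]]].

(** Two or fewer neighbours could be removed without disconnecting the graph, yet would cut the
    component off from a remaining vertex of [W]. *)
Lemma three_neighbours n : 2 < #|W| -> n \in nu @: (~: W) -> 2 < #|[set w | nbr n w]|.
Proof.
move=> W3 /imsetP[k]; rewrite inE => kW nk; rewrite ltnNge; apply/negP => S2.
have /set0Pn[w] : W :\: [set w | nbr n w] != set0.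
  rewrite -card_gt0 cardsD subn_gt0; apply: leq_ltn_trans W3.
  exact: leq_trans (subset_leq_card (subsetIr _ _)) S2.
rewrite inE => /andP[wS wW].
have kS : k \notin [set w | nbr n w] by rewrite inE /nbr (negPf kW).
have /= conn := e_3conn.2 _ S2 k w kS wS.
have := connect_stable (X := fun x => (x \notin W) && (nu x == n)) conn.
rewrite kW nk eqxx wW /= => H; suff : false by []; apply: H => // a b.
move=> /and3P[eab _ bS] /andP[aW /eqP an].
have bW : b \notin W.
  apply: contra bS => bW; rewrite inE /nbr bW /=; apply/existsP; exists a.
  by rewrite aW an eqxx.
by rewrite bW -(nu_sep eab aW bW) an eqxx.
Qed.

(** The bipartite minor has the vertices of [W] on the left and the components on the right. Each
    component has degree at least 3, so [3 c + 2 <= 2 (|W| + c)]. *)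
Lemma components_sparse : 2 < #|W| -> c + 2 <= 2 * #|W|.
Proof.
move=> W3.
pose h (u u' : T + T) := match u, u' with
  | inl w, inr n => nbr n w | inr n, inl w => nbr n w | _, _ => false end.
have h_sym : symmetric h by move=> [x|x] [y|y].
pose B (u : T + T) := match u with
  | inl w => [set w' in W | w' == w] | inr n => [set v in ~: W | nu v == n] end.
have h_dual : has_dual h.
  apply: (@minor_dual _ _ e h B) => //.
  - by move=> [x|x].
  - move=> [w|n] [w'|n'] x; rewrite !inE.
    + by move=> /andP[_ /eqP->] /andP[_ /eqP->].
    + by move=> /andP[->].
    + by move=> /andP[/negPf->].
    + by move=> /andP[_ /eqP->] /andP[_ /eqP->].
  - move=> [w|n] x y; last exact: nu_conn.
    by rewrite !inE => /andP[_ /eqP->] /andP[_ /eqP->]; apply: connect0.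
  - move=> [w|n] [w'|n'] //= /andP[wW /existsP[k /and3P[kW kn ekw]]].
      by exists w, k; rewrite !inE kW kn wW eqxx e_sym ekw.
    by exists k, w'; rewrite !inE kW kn wW eqxx ekw.
pose D := [set u : T + T | match u with inl w => w \in W | inr n => n \in nu @: (~: W) end].
have cardD : #|D| <= #|W| + c.
  have -> : D = inl @: W :|: inr @: (nu @: (~: W)).
    apply/setP => -[w|n]; rewrite !inE.
      rewrite (mem_imset _ _ (@inl_inj _ _)); apply/esym/orb_idr.
      by move=> /imsetP[].
    rewrite [X in _ = _ || X](mem_imset _ _ (@inr_inj _ _)); apply/esym/orb_idl.
    by move=> /imsetP[].
  apply: leq_trans (leq_card_setU _ _) _.
  by rewrite leq_add // leq_imset_card.
have D0 : D != set0.
  have /set0Pn[w wW] : W != set0 by rewrite -card_gt0; apply: leq_trans W3.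
  by apply/set0Pn; exists (inl w); rewrite inE.
pose R := [set u : T + T | if u is inr _ then true else false].
have h_bip x y : h x y -> (x \in R) != (y \in R).
  by case: x y => [x|x] [y|y] //=; rewrite !inE.
have h_supp x y : h x y -> x \in D.
  case: x y => [x|x] [y|y] //=; rewrite inE => /andP[yW] //.
  by move=> /existsP[k /and3P[kW /eqP <- _]]; apply: imset_f; rewrite inE.
have := @dual_sparse _ h R D h_sym h_bip h_supp h_dual D0.
rewrite (card_pairs (fun x y => h x y && (x \in R))) => ED.
suff E3 : 3 * c <= \sum_x \sum_y h x y && (x \in R).
  by move: E3 ED cardD; clear; lia.
rewrite mulnC -sum_nat_const.
apply: (@leq_trans (\sum_(x in inr @: (nu @: (~: W))) \sum_y h x y && (x \in R))).
  have inr_inj2 : {in nu @: (~: W) &, injective (@inr T T)} by move=> x y _ _ [->].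
  rewrite (big_imset _ inr_inj2) /=.
  apply: leq_sum => n nC; apply: leq_trans (three_neighbours W3 nC) _.
  rewrite -sum1_card -(big_imset (fun _ => 1) (h := @inl T T)) /=; last first.
    by move=> x y _ _ [->].
  rewrite [X in X <= _]big_mkcond; apply: leq_sum => u _.
  case: ifP => // /imsetP[w]; rewrite inE => nw ->.
  by rewrite /= nw inE.
by rewrite [X in X <= _]big_mkcond; apply: leq_sum => u _; case: ifP.
Qed.

End Components.

(** The one vertex that [D] may omit is added to [W]. If the result has three or more vertices, this
    still gives [c <= 2 |W|], and [induced_sparse] makes the sum strict. *)
Lemma planar_count (D W : {set T}) (nu : T -> T) (g : rel T) :
  #|~: D| <= 1 -> (forall x y, g x y = [&& e x y, x \in D & y \in D]) ->
  W \subset D -> W != set0 ->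
  (forall n, {in [set v in D :\: W | nu v == n] &, forall x y,
     connect [rel a b | [&& g a b, a \in [set v in D :\: W | nu v == n] &
                         b \in [set v in D :\: W | nu v == n]]] x y}) ->
  (forall x y, g x y -> x \notin W -> y \notin W -> nu x = nu y) ->
  #|[set a | [&& g a.1 a.2, a.1 \in W & a.2 \in W]]| + 2 * #|nu @: (D :\: W)|
    < 8 * #|W|.
Proof.
move=> D1 gE WD W0 conn sep; pose W' := W :|: ~: D.
have DW : D :\: W = ~: W' by rewrite setCU setCK setDE setIC.
have W'c : #|W'| <= #|W| + 1.
  by apply: leq_trans (leq_card_setU _ _) _; rewrite leq_add2l.
have Wc : 0 < #|W| by rewrite card_gt0.
have gW : #|[set a | [&& g a.1 a.2, a.1 \in W & a.2 \in W]]| + 4 <= 4 * #|W|.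
  apply: leq_trans (induced_sparse W0); rewrite leq_add2r.
  apply/subset_leq_card/subsetP => a; rewrite !inE gE.
  by move=> /and3P[/and3P[-> _ _] -> ->].
rewrite DW in conn *.
have conn' n : {in [set v in ~: W' | nu v == n] &, forall x y,
  connect [rel a b | [&& e a b, a \in [set v in ~: W' | nu v == n] &
                      b \in [set v in ~: W' | nu v == n]]] x y}.
  move=> x y xF yF; have := conn n x y xF yF; apply: connect_sub => a b /=.
  by rewrite gE => /and3P[/and3P[eab _ _] aF bF]; apply: connect1; rewrite /= eab aF.
have sep' x y : e x y -> x \notin W' -> y \notin W' -> nu x = nu y.
  rewrite !inE !negb_or !negbK => exy /andP[xW xD] /andP[yW yD].
  by apply: sep; rewrite // gE exy xD yD.
have [W3|W2] := ltnP 2 #|W'|.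
  by have := components_sparse conn' sep' W3; move: gW W'c Wc; clear; lia.
by have := components_le1 sep' W2; move: gW Wc; clear; lia.
Qed.

End PlanarCount.

Lemma proper_of_dual (T : finType) (e : rel T) :
  symmetric e -> irreflexive e -> k_connected e 3 -> has_dual e -> bipartite e ->
  exists o : rel T,
    proper_orientation e o /\ (forall v : T, (indegree o v <= 6)%N).
Proof.
move=> e_sym e_irr e_3conn e_dual [A0 A0_bip].
have /card_gt0P[v _] : 0 < #|T| by apply: leq_trans e_3conn.1.
(* With [v] in [A], the neighbours of [v] are to have even indegrees. *)
have [A [vA A_bip]] : exists A : {set T}, v \in A /\
    forall x y, e x y -> (x \in A) != (y \in A).
  case vA: (v \in A0); first by exists A0.
  exists (~: A0); rewrite inE vA; split=> // x y /A0_bip.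
  by rewrite !inE; case: (x \in A0); case: (y \in A0).
have conn0 x y : connect e x y.
  have := e_3conn.2 set0; rewrite cards0 => /(_ isT x y); rewrite !inE => /(_ isT isT).
  by apply: connect_sub => a b /= /and3P[/connect1].
(* All edges at [v] leave it and the others follow the ranks; so [v] has indegree 0 and [b v]
   holds. *)
pose o1 x y := e x y && ((x == v) || (y != v) && (enum_rank x < enum_rank y)).
have o1_or : orientation e o1.
  split=> [x y /andP[]//|x y exy]; rewrite /o1 (e_sym y x) exy /=.
  have xy : x != y by apply: contraTneq exy => ->; rewrite e_irr.
  have [xv|xv] /= := eqVneq x v; first by rewrite -xv eq_sym (negPf xy).
  have [yv|yv] //= := eqVneq y v.
  have : enum_rank x != enum_rank y :> nat by rewrite (inj_eq val_inj) (inj_eq enum_rank_inj).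
  by case: ltngtP.
have o1v : indegree o1 v = 0.
  apply: eq_card0 => x; rewrite !inE /o1 eqxx /= orbF; apply/negbTE.
  by apply/nandP; case: eqP => [->|]; rewrite ?e_irr; [left|right].
pose b x := odd (indegree o1 x) (+) (x \in A).
have case1 o : orientation e o -> (forall x, odd (indegree o x) = (x \in A)) ->
    (forall x, indegree o x <= 6) ->
    proper_orientation e o /\ (forall v, indegree o v <= 6).
  move=> o_or o_odd o6; split=> //; split=> // x y exy E.
  by have := A_bip _ _ exy; rewrite -!o_odd E eqxx.
case b0: (\xor_x b x); last first.
  have [||t [ts te tb]] := @join_exists _ e setT b e_sym _ _ b0.
  - by move=> x y _ _; apply: conn0.
  - by move=> x _; rewrite inE.
  have [|||o2 [o2_or o2_odd o26]] := @bounded_parity_orientation _ e setT (flip o1 t) e_sym e_irr.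
  - by move=> x y _; rewrite inE.
  - exact: flip_orientation.
  - move=> W nu WD W0 conn sep; apply: (@planar_count T e A _ _ _ _ _ setT) => //.
    + by rewrite setCT cards0.
    + by move=> x y; rewrite !inE !andbT.
  exists o2; apply: case1 => // x.
  by rewrite o2_odd odd_indegree_flip // tb addKb.
(* The number of defects is odd and [v] is one of them, so an even number remains in [G - v], which
   is connected by 3-connectivity. *)
pose D := [set~ v].
pose g x y := [&& e x y, x \in D & y \in D].
have g_sym : symmetric g by move=> x y; rewrite /g e_sym [(x \in D) && _]andbC.
have g_irr : irreflexive g by move=> x; rewrite /g e_irr.
pose b' x := (x != v) && b x.
have b'0 : \xor_x b' x = false.
  move: b0; rewrite (bigD1 v) //= {1}/b o1v vA /= => /negbTE {}b0.
  by rewrite -[RHS]b0 [RHS]big_mkcond; apply: eq_bigr => x _; rewrite /b'; case: (x != v).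
have D2 : #|~: D| <= 1 by rewrite setCK cards1.
have [||t [ts tg tb]] := @join_exists _ g D b' g_sym _ _ b'0.
- move=> x y; rewrite !inE => xv yv.
  have := e_3conn.2 [set v]; rewrite cards1 => /(_ isT x y); rewrite !inE => /(_ xv yv).
  by apply: connect_sub => c d /= /and3P[ecd cv dv]; apply: connect1;
    rewrite /g ecd /D !in_setC cv dv.
- by move=> x /andP[xv _]; rewrite !inE.
pose o1' x y := [&& o1 x y, x \in D & y \in D].
have o1'_or : orientation g o1'.
  split=> [x y /and3P[/(proj1 o1_or) exy xD yD]|x y /and3P[exy xD yD]].
    by rewrite /g exy xD yD.
  by rewrite /o1' xD yD !andbT (proj2 o1_or).
have o1'_in x : x != v -> indegree o1 x = indegree o1' x + e v x.
  move=> xv; rewrite /indegree (cardD1 v) addnC; congr (_ + _).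
    by apply: eq_card => y; rewrite !inE /o1' !inE xv andbT andbC.
  by rewrite inE /o1 eqxx andbT.
have [|||o2 [o2_or o2_odd o26]] :=
    @bounded_parity_orientation _ g D (flip o1' t) g_sym g_irr.
- by move=> x y /and3P[].
- exact: flip_orientation.
- by move=> W nu WD W0 conn sep; apply: (@planar_count T e A _ _ _ _ _ D).
(* A neighbour of [v] still awaits the arc from [v], so its indegree in [G - v] is odd. *)
have {}o2_odd x : x != v -> odd (indegree o2 x) = e v x (+) (x \in A).
  move=> xv; rewrite o2_odd odd_indegree_flip // tb /b' xv /b o1'_in // oddD.
  by rewrite !addbA addbb; case: (e v x).
have o2v x : o2 x v = false by apply/negP => /(proj1 o2_or)/and3P[_ _]; rewrite !inE eqxx.
have o2v' x : o2 v x = false by apply/negP => /(proj1 o2_or)/and3P[_]; rewrite !inE eqxx.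
pose o x y := o2 x y || ((x == v) && e x y).
have o_in x : indegree o x = indegree o2 x + e v x.
  rewrite /indegree (cardD1 v) inE /o o2v' eqxx /= addnC; congr (_ + _).
  apply: eq_card => y; rewrite !inE; have [->|yv] /= := eqVneq y v; first by rewrite o2v'.
  by rewrite orbF.
have ov : indegree o v = 0.
  by rewrite o_in e_irr addn0; apply: eq_card0 => x; rewrite !inE o2v.
have o_odd x : x != v -> odd (indegree o x) = (x \in A).
  by move=> xv; rewrite o_in oddD o2_odd //; case: (e v x); case: (x \in A).
have o_pos x : e v x -> 0 < indegree o x by move=> vx; rewrite o_in vx addn1.
exists o; split; last first.
  move=> x; have [->|xv] := eqVneq x v; first by rewrite ov.
  rewrite o_in; case vx: (e v x); last by rewrite addn0.
  (* An odd indegree at most 6 is at most 5, so the arc from [v] still fits. *)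
  have := o2_odd x xv; have := A_bip _ _ vx; rewrite vA vx /=; case: (x \in A) => // _.
  by have := o26 x; rewrite leq_eqVlt addn1 => /orP[/eqP->|].
split.
  split=> [x y|x y exy].
    by move=> /orP[/(proj1 o2_or)/and3P[]|/andP[_]].
  rewrite /o (e_sym y x) exy !andbT; have [xv|xv] /= := eqVneq x v.
    by rewrite orbT xv o2v /=; apply: contraTneq exy => ->; rewrite xv e_irr.
  have [yv|yv] /= := eqVneq y v; first by rewrite yv o2v orbT.
  by rewrite !orbF; apply: (proj2 o2_or); rewrite /g exy !inE xv yv.
move=> x y exy E; have [xv|xv] := eqVneq x v.
  by move: exy; rewrite xv => /o_pos; rewrite -E xv ov.
have [yv|yv] := eqVneq y v.
  by move: exy; rewrite yv e_sym => /o_pos; rewrite E yv ov.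
by have := A_bip _ _ exy; rewrite -!o_odd // E eqxx.
Qed.

(** * Plane drawings and the square grid *)

Section Grid.
Variable M : nat.
Notation N := M.+1.
Notation cell := ('I_N * 'I_N)%type.

Definition consecutive (i j : nat) := (i.+1 == j) || (j.+1 == i).

Definition grid_adj : rel cell := fun a b =>
  ((a.1 == b.1) && consecutive a.2 b.2) || ((a.2 == b.2) && consecutive a.1 b.1).

Lemma grid_sym : symmetric grid_adj.
Proof.
by move=> a b; rewrite /grid_adj /consecutive ![b.1 == _]eq_sym ![b.2 == _]eq_sym
  ![(b.1.+1 == _) || _]orbC ![(b.2.+1 == _) || _]orbC.
Qed.

Lemma grid_irr : irreflexive grid_adj.
Proof. by move=> a; rewrite /grid_adj /consecutive; lia. Qed.

Let ext (F : pred cell) (i j : nat) :=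
  [&& i < N, j < N & F (inord i, inord j)].

Lemma xor_ext (F : pred cell) (i j : nat) :
  \xor_b [&& F b, b.1 == i :> nat & b.2 == j :> nat] = ext F i j.
Proof.
rewrite /ext; case: (ltnP i N) => [iN|iN] /=; last first.
  rewrite big1 // => b _; apply/negbTE; rewrite !negb_and.
  have := ltn_ord b.1; lia.
case: (ltnP j N) => [jN|jN] /=; last first.
  rewrite big1 // => b _; apply/negbTE; rewrite !negb_and.
  have := ltn_ord b.2; lia.
rewrite (bigD1 (inord i, inord j)) //= !inordK // !eqxx !andbT big1 ?addbF //.
move=> [b1 b2] /= ne; apply: contraNF ne => /and3P[_ /eqP bi /eqP bj].
by rewrite -bi -bj !inord_val.
Qed.

Lemma xor_neighbours (F : pred cell) a : (forall b, F b -> grid_adj a b) ->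
  \xor_b F b = ((ext F a.1.+1 a.2 (+) ((0 < a.1) && ext F a.1.-1 a.2)) (+)
                (ext F a.1 a.2.+1 (+) ((0 < a.2) && ext F a.1 a.2.-1))).
Proof.
move=> Fa.
have cond (c : bool) i j :
    \xor_b (c && [&& F b, b.1 == i :> nat & b.2 == j :> nat]) = (c && ext F i j).
  by case: c => /=; [exact: xor_ext|rewrite big1].
rewrite -!cond -!xor_ext -!big_split /=; apply: eq_bigr => b _.
case Fb: (F b); last by rewrite /= !andbF.
move/Fa: Fb; rewrite /grid_adj /consecutive -!val_eqE /=; lia.
Qed.

(* Every corner on the boundary of the grid is the outer face [None]. *)
Let corner (i j : nat) : option cell :=
  if [&& 0 < i, i < N, 0 < j & j < N] then Some (inord i, inord j) else None.

(** Cells are the vertices of the grid graph, so its faces are the points where four cells meet;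
    [corner i j] is the lower corner of the cell [(i, j)]. The faces beside an edge are the two ends
    of the side shared by its cells. *)
Let lface (a b : cell) :=
  if a.2 == b.2 then corner (maxn a.1 b.1) a.2
  else corner (minn a.1 b.1) (maxn a.2 b.2).
Let rface (a b : cell) :=
  if a.2 == b.2 then corner (maxn a.1 b.1) a.2.+1
  else corner (minn a.1 b.1).+1 (maxn a.2 b.2).

Lemma lface_sym a b : lface a b = lface b a.
Proof. by rewrite /lface eq_sym maxnC minnC; case: eqP => [->|_] //; rewrite maxnC. Qed.

Lemma rface_sym a b : rface a b = rface b a.
Proof. by rewrite /rface eq_sym maxnC minnC; case: eqP => [->|_] //; rewrite maxnC. Qed.

(** Each corner of the cell [a] is an end of two of its four sides and cancels. A side on the border
    carries no edge, and both its ends are the outer face. *)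
Lemma grid_delta_even phi a : boundary (delta grid_adj lface rface phi) a = false.
Proof.
pose df := delta grid_adj lface rface phi.
rewrite -/df /boundary (@xor_neighbours _ a); last by move=> b /andP[].
pose A i j : bool := phi (corner i j).
have out i j : (i == 0) || (N <= i) || (j == 0) || (N <= j) -> corner i j = None.
  rewrite /corner; case: ifP => //; lia.
have hor i j (iN : i.+1 < N) (jN : j < N) :
    df (inord i, inord j) (inord i.+1, inord j) =
    A i.+1 j (+) A i.+1 j.+1.
  have iN' : i < N by lia.
  rewrite /df /delta /grid_adj /consecutive /lface /rface /= -!val_eqE /= !inordK //.
  rewrite !eqxx /= (maxn_idPr (leqnSn i)) /A.
  by rewrite orbT.
have ver i j (iN : i < N) (jN : j.+1 < N) :
    df (inord i, inord j) (inord i, inord j.+1) =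
    A i j.+1 (+) A i.+1 j.+1.
  have jN' : j < N by lia.
  rewrite /df /delta /grid_adj /consecutive /lface /rface /= -!val_eqE /= !inordK //.
  rewrite !eqxx /= (maxn_idPr (leqnSn j)) minnn /A.
  by rewrite (ltn_eqF (ltnSn j)).
have dsym b b' : df b b' = df b' b.
  by rewrite /df /delta grid_sym lface_sym rface_sym.
have [i [j [-> iN jN]]] : exists i j : nat, [/\ a = (inord i, inord j), i < N & j < N].
  by exists a.1, a.2; rewrite !inord_val; split; [case: a|exact: ltn_ord|exact: ltn_ord].
rewrite /= !inordK //.
have -> : ext (df (inord i, inord j)) i.+1 j = A i.+1 j (+) A i.+1 j.+1.
  rewrite /ext jN; case: (boolP (i.+1 < N)) => iN' /=; first exact: hor.
  by rewrite /A !out ?addbb //; lia.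
have -> : ext (df (inord i, inord j)) i j.+1 = A i j.+1 (+) A i.+1 j.+1.
  rewrite /ext iN; case: (boolP (j.+1 < N)) => jN' /=; first exact: ver.
  by rewrite /A !out ?addbb //; lia.
have -> : (0 < i) && ext (df (inord i, inord j)) i.-1 j = A i j (+) A i j.+1.
  case: i iN => [|i] iN /=; first by rewrite /A !out ?addbb //; lia.
  by rewrite /ext jN dsym hor // (ltn_trans (ltnSn i) iN).
have -> : (0 < j) && ext (df (inord i, inord j)) i j.-1 = A i j (+) A i.+1 j.
  case: j jN => [|j] jN /=; first by rewrite /A !out ?addbb //; lia.
  by rewrite /ext iN dsym ver // (ltn_trans (ltnSn j) jN).
by case: (A i j); case: (A i j.+1); case: (A i.+1 j); case: (A i.+1 j.+1).
Qed.

(** Discrete integration: [Phi i j] counts mod 2 the edges of [z] crossed on the way from the corner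
    [(0, j)], which is the outer face, to [(i, j)]. Evenness of [z] at the cells relates
    neighbouring values of [j]. *)
Lemma grid_dual : has_dual grid_adj.
Proof.
exists (option cell), lface, rface; split.
- exact: lface_sym.
- exact: rface_sym.
- exact: grid_delta_even.
move=> z z_sym zg z0.
pose V i j := [&& 0 < j, j < N, i < N & z (inord i, inord j.-1) (inord i, inord j)].
pose H i j := [&& 0 < i, i < N, j < N & z (inord i.-1, inord j) (inord i, inord j)].
pose Phi i j := \big[addb/false]_(0 <= k < i) V k j.
have HV i j : i < N -> j < N -> V i j (+) V i j.+1 = H i j (+) H i.+1 j.
  move=> iN jN; have := z0 (inord i, inord j).
  rewrite /boundary (@xor_neighbours _ (inord i, inord j)); last by move=> b; apply: zg.
  rewrite /= !inordK // /ext iN jN /=.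
  have -> : (i.+1 < N) && z (inord i, inord j) (inord i.+1, inord j) = H i.+1 j.
    by rewrite /H jN.
  have -> : (j.+1 < N) && z (inord i, inord j) (inord i, inord j.+1) = V i j.+1.
    by rewrite /V iN.
  have -> : [&& 0 < i, i.-1 < N & z (inord i, inord j) (inord i.-1, inord j)] = H i j.
    by rewrite /H iN jN z_sym (leq_ltn_trans (leq_pred i) iN).
  have -> : [&& 0 < j, j.-1 < N & z (inord i, inord j) (inord i, inord j.-1)] = V i j.
    by rewrite /V iN jN z_sym (leq_ltn_trans (leq_pred j) jN).
  by case: (H i.+1 j); case: (V i j.+1); case: (H i j); case: (V i j).
have PhiS i j : Phi i.+1 j = Phi i j (+) V i j by rewrite /Phi big_nat_recr.
have PhiH i j : i <= N -> j < N -> Phi i j (+) Phi i j.+1 = H i j.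
  move=> + jN; elim: i => [|i IH] iN; first by rewrite /Phi !big_nil.
  rewrite !PhiS addbACA IH ?HV //; last exact: ltnW.
  by rewrite addbA addbb.
(* A route across the whole grid ends in the outer face again, where the value has to be false. *)
have PhiN j : j <= N -> Phi N j = false.
  elim: j => [|j IH] jN; first by rewrite /Phi big1.
  have := PhiH N j (leqnn _) jN; rewrite IH; last exact: ltnW.
  by rewrite /H ltnn andbF.
pose phi (w : option cell) := if w is Some (p, q) then Phi p q else false.
have phiE i j : i <= N -> j <= N -> phi (corner i j) = Phi i j.
  move=> iN jN; rewrite /corner; case: ifP => [/and4P[_ iN' _ jN']|] /=.
    by rewrite !inordK.
  move/negbT; rewrite !negb_and -!leqNgt !leqn0 => /or4P[/eqP->|Ni|/eqP->|Nj].
  - by rewrite /Phi big_nil.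
  - have -> : i = N by apply/eqP; rewrite eqn_leq iN.
    by rewrite PhiN.
  - by rewrite /Phi big1.
  - have -> : j = N by apply/eqP; rewrite eqn_leq jN.
    by rewrite /Phi big1 // => k _; rewrite /V ltnn andbF.
exists phi.
have hor i j : i.+1 < N -> j < N ->
    z (inord i, inord j) (inord i.+1, inord j) =
    delta grid_adj lface rface phi (inord i, inord j) (inord i.+1, inord j).
  move=> iN jN; have iN' : i < N by apply: ltnW.
  rewrite /delta /grid_adj /consecutive /lface /rface /= -!val_eqE /= !inordK //.
  rewrite !eqxx /= (maxn_idPr (leqnSn i)) orbT !phiE //; try exact: ltnW.
  by rewrite PhiH ?(ltnW iN) // /H iN jN.
have ver i j : i < N -> j.+1 < N ->
    z (inord i, inord j) (inord i, inord j.+1) =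
    delta grid_adj lface rface phi (inord i, inord j) (inord i, inord j.+1).
  move=> iN jN; have jN' : j < N by apply: ltnW.
  rewrite /delta /grid_adj /consecutive /lface /rface /= -!val_eqE /= !inordK //.
  rewrite !eqxx /= (maxn_idPr (leqnSn j)) minnn (ltn_eqF (ltnSn j)) !phiE //; try exact: ltnW.
  by rewrite PhiS addKb /V iN jN.
have d_sym b b' : delta grid_adj lface rface phi b b' = delta grid_adj lface rface phi b' b.
  by rewrite /delta grid_sym lface_sym rface_sym.
have mk (b : cell) : b = (inord b.1, inord b.2) by rewrite !inord_val; case: b.
move=> a b; have [ab|ab] := boolP (grid_adj a b); last first.
  rewrite /delta (negPf ab); exact: contraNF (zg _ _) ab.
rewrite (mk a) (mk b).
have := ltn_ord a.1; have := ltn_ord a.2; have := ltn_ord b.1; have := ltn_ord b.2.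
case/orP: ab => /andP[/eqP-> /orP[]/eqP<-] *.
- exact: ver.
- by rewrite z_sym d_sym; apply: ver.
- exact: hor.
- by rewrite z_sym d_sym; apply: hor.
Qed.

End Grid.

(** * Branch sets from disks and walks *)

Section BranchSets.
Variables (V T : finType) (adj : rel V) (e : rel T).
Hypotheses (adj_sym : symmetric adj) (adj_irr : irreflexive adj).
Hypotheses (e_sym : symmetric e) (e_irr : irreflexive e).
Variables (a : T -> V) (K : T -> {set V}) (walk : T -> T -> seq V).

(* [K u] plays the disk around [u], and [walk u v] the curve of [uv]; what the
   walk visits outside both disks goes to the branch set of [u], the end of
   smaller rank. *)
Let E u v := e u v && (enum_rank u < enum_rank v).
Let X u v := [set z in walk u v | (z \notin K u) && (z \notin K v)].

Hypothesis a_K : forall u, a u \in K u.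
Hypothesis K_conn : forall u z, z \in K u ->
  connect [rel x y | [&& adj x y, x \in K u & y \in K u]] (a u) z.
Hypothesis K_disj : forall u w z, z \in K u -> z \in K w -> u = w.
Hypothesis walk_path : forall u v, E u v ->
  path (fun x y => (x == y) || adj x y) (a u) (walk u v).
Hypothesis walk_last : forall u v, E u v -> last (a u) (walk u v) = a v.
Hypothesis walk_avoid : forall u v w z, E u v -> z \in X u v -> z \notin K w.
Hypothesis walk_disj : forall u v u' v' z, E u v -> E u' v' ->
  z \in X u v -> z \in X u' v' -> u = u' /\ v = v'.

Let S u := K u :|: \bigcup_(v | E u v) X u v.
(** A walk may enter and leave the disk at its far end, so parts of [S u] may be cut off from [a u];
    only the component of [a u] is used. *)
Let B u := [set z | connect [rel x y | [&& adj x y, x \in S u & y \in S u]] (a u) z].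

Lemma S_disj u w z : z \in S u -> z \in S w -> u = w.
Proof.
case/setUP=> [zu|/bigcupP[v uv zv]] /setUP[zw|/bigcupP[v' wv' zv']].
- exact: K_disj zu zw.
- by rewrite (negPf (walk_avoid _ wv' zv')) in zu.
- by rewrite (negPf (walk_avoid _ uv zv)) in zw.
- by have [] := walk_disj uv wv' zv zv'.
Qed.

Lemma B_sub u : {subset B u <= S u}.
Proof.
move=> z; rewrite inE => /connectP[p pp ->].
have : a u \in S u by rewrite inE a_K.
by elim: p (a u) pp => //= y p IH x /andP[/and3P[_ _ yS] yp] _; apply: IH.
Qed.

Lemma K_sub u : {subset K u <= B u}.
Proof.
move=> z /K_conn; rewrite inE; apply: connect_sub => x y /= /and3P[xy xK yK].
by apply: connect1; rewrite /= xy !inE xK yK.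
Qed.

Lemma restricted_conn_sym (D : {set V}) :
  connect_sym [rel x y | [&& adj x y, x \in D & y \in D]].
Proof.
by apply: sym_connect_sym => x y /=; rewrite adj_sym [(x \in D) && _]andbC.
Qed.

Lemma B_conn u : {in B u &, forall x y,
  connect [rel x y | [&& adj x y, x \in B u & y \in B u]] x y}.
Proof.
have base z : z \in B u -> connect [rel x y | [&& adj x y, x \in B u & y \in B u]] (a u) z.
  rewrite inE => /connectP[p pp ->].
  have := path_restrict (c := B u) pp _; rewrite /= => H.
  apply/connectP; exists p => //.
  apply: sub_path (H _) => [x y /= /and3P[/and3P[-> _ _] -> ->] //|z' z'p].
  by rewrite inE; apply: (path_connect pp).
move=> x y xB yB; apply: connect_trans (base y yB).
by rewrite restricted_conn_sym base.
Qed.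

(** Until it first enters [K v], the walk continues inside [S u] and so stays in [B u]. *)
Lemma walk_exit u v x p : E u v -> x \in B u ->
  path (fun x y => (x == y) || adj x y) x p -> {subset p <= walk u v} ->
  last x p \in K v -> exists y z, [/\ y \in B u, z \in B v & adj y z].
Proof.
move=> uv; have [_ rk] := andP uv.
elim: p x => [|y p IH] x xB /=.
  move=> _ _ xv; have /B_sub := K_sub xv; move/(S_disj (B_sub xB)) => uE.
  by rewrite uE ltnn in rk.
case/andP=> xy yp yw yl.
have pw : {subset p <= walk u v} by move=> z zp; apply: yw; rewrite inE zp orbT.
case/predU1P: xy yp yl => [<-|xy] yp yl; first exact: IH yp pw yl.
have [yK|yK] := boolP (y \in K v); first by exists x, y; split=> //; apply: K_sub.
apply: IH yp pw yl; move: (B_sub xB) => xS; rewrite inE in xB.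
rewrite inE; apply: connect_trans xB (connect1 _); rewrite /= xy xS !inE.
have [//|yu] := boolP (y \in K u); apply/bigcupP; exists v => //.
by rewrite !inE yu yK yw ?mem_head.
Qed.

Lemma branch_sets_dual : has_dual adj -> has_dual e.
Proof.
apply: (@minor_dual _ _ adj e B) => //.
- by move=> u w z /B_sub zu /B_sub /(S_disj zu).
- exact: B_conn.
have dir u v : E u v -> exists y z, [/\ y \in B u, z \in B v & adj y z].
  move=> uv; apply: (walk_exit uv (K_sub (a_K u)) (walk_path uv)) => //.
  by rewrite walk_last.
move=> u v uv; case: (ltngtP (enum_rank u) (enum_rank v)) => [uv'|vu'|/val_inj/enum_rank_inj E'].
- by apply: dir; rewrite /E uv.
- have [|y [z [yB zB yz]]] := dir v u; first by rewrite /E e_sym uv.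
  by exists z, y; rewrite adj_sym.
- by rewrite E' e_irr in uv.
Qed.

End BranchSets.

(** * Walks and square blocks in the grid *)

Section GridWalks.
Variable M : nat.
Notation cell := ('I_M.+1 * 'I_M.+1)%type.
Implicit Types (c d z : cell).

Definition grid_close (k : nat) c d :=
  [&& c.1 <= d.1 + k, d.1 <= c.1 + k, c.2 <= d.2 + k & d.2 <= c.2 + k].

Lemma grid_close_trans k l c d z : grid_close k c d -> grid_close l d z -> grid_close (k + l) c z.
Proof. rewrite /grid_close; lia. Qed.

Lemma grid_close_sym k c d : grid_close k c d = grid_close k d c.
Proof. rewrite /grid_close; lia. Qed.

(** A step between close cells may be diagonal; the extra cell splits it into two steps that change
    at most one coordinate each. The start [c 0] is omitted, as [path] expects. *)
Fixpoint grid_walk (c : nat -> cell) n : seq cell :=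
  if n is n'.+1 then grid_walk c n' ++ [:: ((c n).1, (c n').2); c n] else [::].

Lemma grid_walk_last (c : nat -> cell) n : last (c 0) (grid_walk c n) = c n.
Proof. by case: n => //= n; rewrite last_cat. Qed.

Lemma grid_walk_path (c : nat -> cell) n :
  (forall k, k < n -> grid_close 1 (c k) (c k.+1)) ->
  path (fun x y => (x == y) || @grid_adj M x y) (c 0) (grid_walk c n).
Proof.
elim: n => //= n IH cn; rewrite cat_path IH /=; last by move=> k kn; apply/cn/ltnW.
rewrite grid_walk_last andbT.
have := cn n (ltnSn n); case: (c n) (c n.+1) => [x1 x2] [y1 y2].
rewrite /grid_close /grid_adj /consecutive !xpair_eqE /= -!val_eqE /=; lia.
Qed.

Lemma grid_walk_near (c : nat -> cell) n z :
  (forall k, k < n -> grid_close 1 (c k) (c k.+1)) ->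
  z \in grid_walk c n -> exists2 k, k <= n & grid_close 1 z (c k).
Proof.
elim: n => //= n IH cn; rewrite mem_cat => /orP[/IH[|k kn zk]|].
- by move=> k kn; apply/cn/ltnW.
- by exists k => //; apply: ltnW.
rewrite !inE => /orP[/eqP->|/eqP->]; exists n.+1 => //.
  by have := cn n (ltnSn n); rewrite /grid_close /=; lia.
by rewrite /grid_close; lia.
Qed.

(** Moving one coordinate towards [c] stays in the block and shortens the sum of coordinate
    distances. *)
Lemma block_connected k c z : grid_close k c z ->
  connect [rel x y | [&& grid_adj x y, x \in [set z | grid_close k c z] &
                         y \in [set z | grid_close k c z]]] c z.
Proof.
have [n] := ubnP ((c.1 - z.1) + (z.1 - c.1) + ((c.2 - z.2) + (z.2 - c.2))).
elim: n z => // n IH z; rewrite ltnS => dn zk.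
have [->|zc] := eqVneq z c; first exact: connect0.
suff [z' [zz' z'k dz']] : exists z', [/\ grid_adj z' z, grid_close k c z' &
    (c.1 - z'.1) + (z'.1 - c.1) + ((c.2 - z'.2) + (z'.2 - c.2)) < n].
  by apply: connect_trans (IH z' dz' z'k) (connect1 _); rewrite /= zz' !inE z'k zk.
have c1M := ltn_ord c.1; have c2M := ltn_ord c.2.
have z1M := ltn_ord z.1; have z2M := ltn_ord z.2.
have step1 i : i < M.+1 -> consecutive i z.1 -> (i <= c.1 + k) && (c.1 <= i + k) ->
    (c.1 - i) + (i - c.1) < (c.1 - z.1) + (z.1 - c.1) ->
    exists z', [/\ grid_adj z' z, grid_close k c z' &
      (c.1 - z'.1) + (z'.1 - c.1) + ((c.2 - z'.2) + (z'.2 - c.2)) < n].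
  move=> iM iz ik id; exists (inord i, z.2); split.
  - by rewrite /grid_adj /= inordK // eqxx iz orbT.
  - by move: zk; rewrite /grid_close /= inordK //; lia.
  - by rewrite /= inordK //; lia.
have step2 i : i < M.+1 -> consecutive i z.2 -> (i <= c.2 + k) && (c.2 <= i + k) ->
    (c.2 - i) + (i - c.2) < (c.2 - z.2) + (z.2 - c.2) ->
    exists z', [/\ grid_adj z' z, grid_close k c z' &
      (c.1 - z'.1) + (z'.1 - c.1) + ((c.2 - z'.2) + (z'.2 - c.2)) < n].
  move=> iM iz ik id; exists (z.1, inord i); split.
  - by rewrite /grid_adj /= inordK // eqxx iz.
  - by move: zk; rewrite /grid_close /= inordK //; lia.
  - by rewrite /= inordK //; lia.
move: zk; rewrite /grid_close => zk.
case: (ltngtP z.1 c.1) => [lt1|gt1|eq1].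
- apply: (step1 z.1.+1); rewrite /consecutive; lia.
- apply: (step1 z.1.-1); rewrite /consecutive; lia.
case: (ltngtP z.2 c.2) => [lt2|gt2|eq2].
- apply: (step2 z.2.+1); rewrite /consecutive; lia.
- apply: (step2 z.2.-1); rewrite /consecutive; lia.
case/eqP: zc; move: eq1 eq2; case: (z) (c) => [z1 z2] [c1 c2] /=.
by move=> /val_inj-> /val_inj->.
Qed.

End GridWalks.

From mathcomp Require Import all_boot all_order all_algebra.
From mathcomp Require Import all_classical all_reals all_analysis.
From mathcomp Require Import lra.

Import Order.TTheory GRing.Theory Num.Theory.
Import numFieldNormedType.Exports.

(** * From plane drawings to minors of a grid *)

Section PlaneDrawings.
Local Open Scope classical_set_scope.
Local Open Scope ring_scope.

Lemma compact_closed_separated (R : realType) (X : pseudoMetricType R)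
    (K F : set X) : compact K -> closed F -> (forall p, K p -> ~ F p) ->
  exists2 eps : R, 0 < eps & forall p q, K p -> F q -> ~ ball p eps q.
Proof.
move=> /compact_near_coveringP cK cF KF.
have cov x : K x -> \forall x' \near x & eps \near (0 : R)^'+,
    forall q, F q -> ~ ball x' eps q.
  move=> Kx.
  have : nbhs x (~` F) by apply: open_nbhs_nbhs; split; [exact: closed_openC|exact: KF].
  move=> /nbhs_ballP[d /= d0 dF].
  exists (ball x (d / 2), [set i : R | i < d / 2]) => /=.
    split; first by apply: nbhsx_ballx; rewrite divr_gt0.
    by apply: nbhs_right_lt; rewrite divr_gt0.
  move=> [y i] /= [xy id] q Fq yq; apply: (dF q) => //.
  rewrite [d]splitr; apply: ball_triangle xy _.
  by apply: le_ball yq; exact: ltW.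
have H := cK _ (0 : R)^'+ (fun eps p => forall q, F q -> ~ ball p eps q)
  (at_right_proper_filter 0) cov.
have /= [eps [/= Heps eps0]] := @filter_ex _ _ (at_right_proper_filter 0) _
  (@filterI _ _ (at_right_proper_filter 0) _ _ H (nbhs_right_gt (0 : R))).
by exists eps => // p q Kp Fq; apply: Heps.
Qed.

Lemma segment_unif_continuous (R : realType) (X : pseudoMetricType R) (g : R -> X) :
  {within `[0, 1], continuous g} -> forall eta : R, 0 < eta ->
  exists2 eps : R, 0 < eps & forall s t : R, `[0, 1]%classic s -> `[0, 1]%classic t ->
    `|s - t| < eps -> ball (g s) eta (g t).
Proof.
move=> /subspace_continuousP gc eta eta0.
have /compact_near_coveringP cK := @segment_compact R 0 1.
have cov (x : R) : `[0, 1]%classic x -> \forall s \near x & eps \near (0 : R)^'+,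
    `[0, 1]%classic s -> forall t, `[0, 1]%classic t -> `|s - t| < eps -> ball (g s) eta (g t).
  move=> x01; have eta20 : 0 < eta / 2 by rewrite divr_gt0.
  have := gc x x01 (ball (g x) (eta / 2)) (nbhsx_ballx _ _ eta20).
  move=> /nbhs_ballP[d /= d0 dg].
  exists (ball x (d / 2), [set i : R | i < d / 2]) => /=.
    split; first by apply: nbhsx_ballx; rewrite divr_gt0.
    by apply: nbhs_right_lt; rewrite divr_gt0.
  move=> [s i] /= [xs id] s01 t t01 st.
  rewrite [eta]splitr; apply: (@ball_triangle _ _ (g x)).
    apply/ball_sym/dg => //; apply: le_ball xs.
    by rewrite ler_pdivrMr // ler_pMr // ler1n.
  apply: dg => //; rewrite [d]splitr; apply: ball_triangle xs _.
  by rewrite -ball_normE /=; apply: lt_trans st id.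
have H := cK _ (0 : R)^'+ (fun eps s => `[0, 1]%classic s -> forall t, `[0, 1]%classic t ->
   `|s - t| < eps -> ball (g s) eta (g t)) (at_right_proper_filter 0) cov.
have /= [eps [/= Heps eps0]] := @filter_ex _ _ (at_right_proper_filter 0) _
  (@filterI _ _ (at_right_proper_filter 0) _ _ H (nbhs_right_gt (0 : R))).
by exists eps => // s t s01 t01; apply: Heps.
Qed.

Lemma uniform_eps (R : realType) (I : finType) (P : I -> R -> Prop) :
  (forall i, exists2 eps, 0 < eps & P i eps) ->
  (forall i e1 e2, e2 <= e1 -> P i e1 -> P i e2) ->
  exists2 eps, 0 < eps & forall i, P i eps.
Proof.
move=> Pex Pdown.
have H : \forall eps \near (0 : R)^'+, forall i, P i eps.
  apply: filter_forall => i; have [e1 e10 Pe1] := Pex i.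
  have : \forall eps \near (0 : R)^'+, eps <= e1 by exact: nbhs_right_le.
  by apply: filterS => e2 /Pdown; apply.
have /= [eps [/= Heps eps0]] := @filter_ex _ _ (at_right_proper_filter 0) _
  (@filterI _ _ (at_right_proper_filter 0) _ _ H (nbhs_right_gt (0 : R))).
by exists eps.
Qed.

Section Cells.
Variables (R : realType) (b d : R).
Hypotheses (d0 : 0 < d).

Definition in_box (q : R * R) := `|q.1| <= b /\ `|q.2| <= b.

Let index (x : R) : nat := Num.truncn ((x + b) / d).
Definition cell_count : nat := index b.
Let M := cell_count.

Definition cell_of (q : R * R) : 'I_M.+1 * 'I_M.+1 :=
  (inord (index q.1), inord (index q.2)).

Lemma index_lt (x : R) : `|x| <= b -> (index x < M.+1)%N.
Proof.
move=> xb; rewrite ltnS; apply: le_truncn.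
by rewrite ler_pM2r ?invr_gt0 // lerD2r (le_trans (ler_norm x)).
Qed.

Lemma index_itv (x : R) : `|x| <= b ->
  (index x)%:R * d <= x + b < ((index x)%:R + 1) * d.
Proof.
move=> xb; have x0 : 0 <= x + b.
  by rewrite -lerBlDr sub0r; have /ler_normlP[] := xb; rewrite lerNl.
have := @truncn_itv R ((x + b) / d) (divr_ge0 x0 (ltW d0)).
by rewrite -/(index x) ler_pdivlMr // ltr_pdivrMr // -natr1.
Qed.

Lemma index_close (x y : R) (k : nat) : `|x| <= b -> `|y| <= b ->
  x - y < k%:R * d -> (index x <= index y + k)%N.
Proof.
move=> xb yb xy; have /andP[x1 _] := index_itv xb; have /andP[_ y2] := index_itv yb.
rewrite -ltnS -(ltr_nat R) -natr1 natrD -(ltr_pM2r d0).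
by apply: le_lt_trans x1 _; move: xy y2; lra.
Qed.

Lemma index_dist (x y : R) (k : nat) : `|x| <= b -> `|y| <= b ->
  (index x <= index y + k)%N -> x - y < k.+1%:R * d.
Proof.
move=> xb yb; rewrite -(ler_nat R) natrD -(ler_pM2r d0).
have /andP[_ x2] := index_itv xb; have /andP[y1 _] := index_itv yb.
by rewrite -natr1; move: x2 y1; lra.
Qed.

Lemma cell_close (p q : R * R) (k : nat) : in_box p -> in_box q ->
  ball p (k%:R * d) q -> grid_close k (cell_of p) (cell_of q).
Proof.
move=> [p1 p2] [q1 q2] [/= B1 B2].
move: B1 B2; rewrite -!ball_normE /= => /ltr_normlP[B1 B1'] /ltr_normlP[B2 B2'].
rewrite /grid_close /cell_of /= !inordK ?index_lt //.
by apply/and4P; split; apply: index_close => //; lra.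
Qed.

(** Rounding to cells of width [d] can hide almost one more width, hence [k.+1]. *)
Lemma cell_dist (p q : R * R) (k : nat) : in_box p -> in_box q ->
  grid_close k (cell_of p) (cell_of q) -> ball p (k.+1%:R * d) q.
Proof.
move=> [p1 p2] [q1 q2]; rewrite /grid_close /cell_of /= !inordK ?index_lt //.
case/and4P=> /(index_dist p1 q1) c1 /(index_dist q1 p1) c2.
move=> /(index_dist p2 q2) c3 /(index_dist q2 p2) c4.
by split; rewrite -ball_normE /=; apply/ltr_normlP; split; lra.
Qed.

End Cells.

Lemma compact_in_box (R : realType) (K : set (R * R)) : compact K ->
  exists b, forall q, K q -> in_box b q.
Proof.
move=> /compact_bounded[b [_ Hb]]; exists (b + 1) => q Kq.
have := Hb (b + 1) _ q Kq; rewrite ltrDl => /(_ ltr01) /=.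
by rewrite prod_normE ge_max => /andP[].
Qed.

(** The drawing is laid over a grid of mesh [d]: the cells near a vertex form its disk, and the
    cells of sample points along a curve give the walk of the edge. *)
Lemma planar_has_dual (R : realType) (T : finType) (e : rel T) :
  symmetric e -> irreflexive e -> planar R e -> has_dual e.
Proof.
move=> e_sym e_irr [pos [C [pos_inj C_arc C_vert C_cross]]].
have /fin_all_exists[g gP] (w : T * T) : exists g : R -> R * R, e w.1 w.2 ->
    [/\ {within `[0, 1], continuous g}, g 0 = pos w.1, g 1 = pos w.2 &
        C [set w.1; w.2]%SET = g @` `[0, 1]].
  case ew: (e w.1 w.2); last by exists (fun _ => 0).
  by have [g [gc _ g0 g1 gC]] := C_arc _ _ ew; exists g.
have C_compact u v : e u v -> compact (C [set u; v]%SET).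
  move=> euv; have [gc _ _ ->] := gP (u, v) euv.
  exact: continuous_compact gc (@segment_compact _ _ _).
have C_closed u v : e u v -> closed (C [set u; v]%SET).
  by move=> euv; apply: compact_closed; [exact: norm_hausdorff|exact: C_compact].
have pos_closed w : closed [set pos w].
  by apply: compact_closed; [exact: norm_hausdorff|exact: compact_set1].
have [rho1 rho10 sep_pos] : exists2 eps : R, 0 < eps &
    forall w : T * T, w.1 != w.2 -> ~ ball (pos w.1) eps (pos w.2).
  apply: uniform_eps => [[u v] /=|w e1 e2 e12 H /H + B]; last first.
    by apply; apply: le_ball B.
  have [uv|uv] := eqVneq u v; first by exists 1.
  have [|eps eps0 H] := compact_closed_separated (@compact_set1 _ (pos u)) (pos_closed v).
    by move=> p /= -> /pos_inj uv'; rewrite uv' eqxx in uv.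
  by exists eps => // _; apply: H.
have [rho2 rho20 sep_vert] : exists2 eps : R, 0 < eps &
    forall w : T * T * T, e w.1.1 w.1.2 -> w.2 \notin [set w.1.1; w.1.2]%SET ->
      forall q, C [set w.1.1; w.1.2]%SET q -> ~ ball (pos w.2) eps q.
  apply: uniform_eps => [[[u v] w] /=|w e1 e2 e12 H ew wN q Cq B]; last first.
    by apply: (H ew wN q Cq); apply: le_ball B.
  case euv: (e u v); last by exists 1.
  have [wuv|wuv] := boolP (w \in [set u; v]%SET); first by exists 1.
  have [|eps eps0 H] := compact_closed_separated (@compact_set1 _ (pos w)) (C_closed u v euv).
    by move=> p /= -> /(C_vert _ _ _ euv); rewrite (negPf wuv).
  by exists eps => // _ _ q Cq; apply: H.
(* The factor 3 absorbs rounding: disks reach [m + 1] cells, so if two meet, their centres are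
   within [(2 m + 3) d <= 3 rho] once [m >= 3]. *)
pose rho := Num.min rho1 rho2 / 3.
have rho0 : 0 < rho by rewrite divr_gt0 // lt_min rho10.
have rho_1 : 3 * rho <= rho1 by rewrite /rho mulrC divfK ?ge_min ?lexx.
have rho_2 : 3 * rho <= rho2 by rewrite /rho mulrC divfK ?ge_min ?lexx ?orbT.
(* Curves may meet at a common end, so they are uniformly separated only away from the vertices. *)
pose far := [set q | forall w, ~ ball (pos w) rho q].
have far_closed : closed far.
  have -> : far = \bigcap_(w in setT) ~` ball (pos w) rho.
    by apply/seteqP; split=> q H w; [move=> _; exact: H|exact: H].
  by apply: closed_bigI => w _; apply: open_closedC; exact: ball_open.
have [eta eta0 sep_edge] : exists2 eps : R, 0 < eps &
    forall w : (T * T) * (T * T), e w.1.1 w.1.2 -> e w.2.1 w.2.2 ->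
      [set w.1.1; w.1.2]%SET != [set w.2.1; w.2.2]%SET ->
      forall p q, C [set w.1.1; w.1.2]%SET p -> far p ->
        C [set w.2.1; w.2.2]%SET q -> far q -> ~ ball p eps q.
  apply: uniform_eps => [[[u v] [x y]] /=|w e1 e2 e12 H E1 E2 E3 p q Cp fp Cq fq B]; last first.
    by apply: (H E1 E2 E3 p q Cp fp Cq fq); apply: le_ball B.
  case euv: (e u v); last by exists 1.
  case exy: (e x y); last by exists 1.
  have [E|E] := eqVneq [set u; v]%SET [set x; y]%SET; first by exists 1.
  have [|||eps eps0 H] := @compact_closed_separated R _ (C [set u; v]%SET `&` far)
      (C [set x; y]%SET `&` far) _ _.
  - apply: subclosed_compact (C_compact _ _ euv) _; last by move=> q [].
    by apply: closedI => //; apply: C_closed.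
  - by apply: closedI => //; apply: C_closed.
  - move=> p [Cp fp] [Cp' _].
    have [w _ pE] := C_cross _ _ _ _ euv exy E p (conj Cp Cp').
    by apply: (fp w); rewrite pE; apply: ballxx.
  by exists eps => // _ _ _ p q Cp fp Cq fq; apply: H.
(* The mesh [d = rho / m] is to be at most [eta / 3]: two walks sharing a cell come from curve
   points within [3 d]. *)
have [m m3 m_eta] : exists2 m : nat, 3 <= m%:R :> R & 3 * rho / eta <= m%:R.
  exists (Num.truncn (3 * rho / eta)).+3; first by rewrite ler_nat.
  have ge0 := divr_ge0 (mulr_ge0 (ler0n R 3) (ltW rho0)) (ltW eta0).
  have /andP[_ lt_m] := truncn_itv ge0.
  by apply: le_trans (ltW lt_m) _; rewrite ler_nat ltnS (leq_trans (leqnSn _)).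
have m0 : 0 < m%:R :> R by apply: lt_le_trans m3; rewrite ltr0n.
pose d := rho / m%:R.
have d0 : 0 < d by rewrite divr_gt0.
have md : m%:R * d = rho by rewrite /d mulrC divfK ?gt_eqF.
have d_eta : 3%:R * d <= eta.
  by rewrite /d mulrA ler_pdivrMr // [eta * _]mulrC -ler_pdivrMr.
have [b boxP] : exists b : R, forall q, ((exists w, q = pos w) \/
    (exists u v, e u v /\ C [set u; v]%SET q)) -> in_box b q.
  have /fin_all_exists[b1 b1P] (w : T) : exists b : R, in_box b (pos w).
    by have [b H] := compact_in_box (@compact_set1 _ (pos w)); exists b; apply: H.
  have /fin_all_exists[b2 b2P] (w : T * T) : exists b : R, e w.1 w.2 ->
      forall q, C [set w.1; w.2]%SET q -> in_box b q.
    case ew: (e w.1 w.2); last by exists 0.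
    by have [b H] := compact_in_box (C_compact _ _ ew); exists b.
  have mono (x y : R) q : x <= y -> in_box x q -> in_box y q.
    by move=> xy [q1 q2]; split; apply: le_trans xy.
  pose B1 := \big[Order.max/0]_w b1 w; pose B2 := \big[Order.max/0]_w b2 w.
  exists (Order.max B1 B2) => q [[w ->]|[u [v [euv Cq]]]].
    apply: mono (b1P w); rewrite le_max; apply/orP; left; exact: le_bigmax.
  apply: mono (b2P (u, v) euv q Cq); rewrite le_max; apply/orP; right; exact: le_bigmax.
have pos_box w : in_box b (pos w) by apply: boxP; left; exists w.
have C_box u v q : e u v -> C [set u; v]%SET q -> in_box b q.
  by move=> euv Cq; apply: boxP; right; exists u, v.
have [eps eps0 g_unif] : exists2 eps : R, 0 < eps & forall w : T * T, e w.1 w.2 ->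
    forall s t : R, `[0, 1]%classic s -> `[0, 1]%classic t ->
    `|s - t| < eps -> ball (g w s) (1%:R * d) (g w t).
  apply: uniform_eps => [w|w e1 e2 e12 H ew s t s01 t01 st]; last first.
    by apply: H => //; apply: lt_le_trans e12.
  case ew: (e w.1 w.2); last by exists 1.
  have [gc _ _ _] := gP w ew; rewrite mul1r.
  by have [eps eps0 H] := segment_unif_continuous gc d0; exists eps.
(* As [1 / n < eps], consecutive samples are within [d] and lie in close cells. *)
pose n := (Num.truncn eps^-1).+1.
have n0 : 0 < n%:R :> R by rewrite ltr0n.
have n_eps : n%:R^-1 < eps.
  rewrite invf_plt ?posrE //.
  have epsV0 : 0 <= eps^-1 by rewrite invr_ge0 ltW.
  by have /andP[_] := truncn_itv epsV0.
pose cl := cell_of b d.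
pose sample u v k := g (u, v) (k%:R / n%:R).
have sample01 k : (k <= n)%N -> `[0, 1]%classic (k%:R / n%:R : R).
  move=> kn; rewrite /= in_itv /= divr_ge0 //= ler_pdivrMr // mul1r ler_nat //.
have sampleC u v k : e u v -> (k <= n)%N -> C [set u; v]%SET (sample u v k).
  move=> euv kn; have [_ _ _ ->] := gP (u, v) euv.
  by exists (k%:R / n%:R) => //; apply: sample01.
have step u v k : e u v -> (k < n)%N ->
    grid_close 1 (cl (sample u v k)) (cl (sample u v k.+1)).
  move=> euv kn; apply: cell_close => //.
  - by apply: (C_box _ _ _ euv); apply: sampleC => //; apply: ltnW.
  - by apply: (C_box _ _ _ euv); apply: sampleC.
  apply: g_unif => //; [exact/sample01/ltnW|exact: sample01|].
  rewrite -mulrBl -natr1 opprD addNKr mulN1r normrN ger0_norm ?invr_ge0 //.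
pose walk u v := grid_walk (fun k => cl (sample u v k)) n.
(* The radius exceeds [m] by one: a cell next to that of a point within [rho = m d] of a vertex has
   to lie in its disk, so that walks outside the disks come from [far] points. *)
pose K u := [set z | grid_close m.+1 (cl (pos u)) z]%SET.
have walk0 u v : e u v -> cl (sample u v 0) = cl (pos u).
  by move=> euv; rewrite /sample mul0r; have [_ -> _ _] := gP (u, v) euv.
have walkn u v : e u v -> cl (sample u v n) = cl (pos v).
  by move=> euv; rewrite /sample divff ?gt_eqF //; have [_ _ -> _] := gP (u, v) euv.
have walk_near u v z : e u v -> z \in walk u v -> exists2 q,
    C [set u; v]%SET q & grid_close 1 z (cl q).
  move=> euv /(grid_walk_near (fun k => step u v k euv))[k kn zk].
  by exists (sample u v k) => //; apply: sampleC.
have close_vert u v z q w : e u v -> C [set u; v]%SET q -> grid_close 1 z (cl q) ->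
    z \in K w -> w \in [set u; v]%SET.
  move=> euv Cq zq; rewrite inE => wz; apply/negPn/negP => wN.
  have wq := grid_close_trans wz zq.
  apply: (sep_vert (u, v, w) euv wN q Cq).
  have := cell_dist d0 (pos_box w) (C_box _ _ _ euv Cq) wq; apply: le_ball.
  apply: le_trans rho_2; rewrite -md mulrA ler_pM2r // addn1 -!natr1.
  by move: m3; lra.
have avoid u v w z : e u v -> z \in walk u v -> z \notin K u -> z \notin K v -> z \notin K w.
  move=> euv /(walk_near _ _ _ euv)[q Cq zq] zu zv; apply/negP => zw.
  have := close_vert _ _ _ _ _ euv Cq zq zw; rewrite !inE => /orP[] /eqP wE.
    by rewrite wE (negPf zu) in zw.
  by rewrite wE (negPf zv) in zw.
have far_near u v z q : e u v -> C [set u; v]%SET q -> grid_close 1 z (cl q) ->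
    z \notin K u -> z \notin K v -> far q.
  move=> euv Cq zq zu zv w; rewrite -md => B.
  have wq := cell_close d0 (pos_box w) (C_box _ _ _ euv Cq) B.
  have wz : z \in K w.
    by rewrite inE -addn1; apply: grid_close_trans wq _; rewrite grid_close_sym.
  have := close_vert _ _ _ _ _ euv Cq zq wz; rewrite !inE => /orP[] /eqP wE.
    by rewrite wE (negPf zu) in wz.
  by rewrite wE (negPf zv) in wz.
apply: (@branch_sets_dual _ _ (@grid_adj _) e (@grid_sym _) (@grid_irr _) e_sym e_irr
  (fun u => cl (pos u)) K walk _ _ _ _ _ _ _ (@grid_dual _)).
- by move=> u; rewrite inE /grid_close !leq_addr.
- by move=> u z; rewrite inE; apply: block_connected.
- move=> u w z; rewrite !inE => uz wz; apply/eqP/negPn/negP => uw.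
  apply: (sep_pos (u, w) uw) => /=.
  rewrite grid_close_sym in wz.
  have := cell_dist d0 (pos_box u) (pos_box w) (grid_close_trans uz wz); apply: le_ball.
  apply: le_trans rho_1; rewrite -md mulrA ler_pM2r // -natr1 natrD -natr1.
  by move: m3; lra.
- move=> u v /andP[euv _]; rewrite -(walk0 u v euv).
  by apply: (grid_walk_path (c := fun k => cl (sample u v k))) => k; apply: step.
- move=> u v /andP[euv _]; rewrite -(walk0 u v euv) -(walkn u v euv).
  exact: (grid_walk_last (fun k => cl (sample u v k))).
- move=> u v w z /andP[euv _]; rewrite inE => /and3P[zw zu zv].
  exact: avoid euv zw zu zv.
- move=> u v u' v' z /andP[euv uv] /andP[euv' uv'].
  rewrite inE => /and3P[zw zu zv]; rewrite inE => /and3P[zw' zu' zv'].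
  have [q Cq zq] := walk_near _ _ _ euv zw.
  have [q' Cq' zq'] := walk_near _ _ _ euv' zw'.
  have fq := far_near _ _ _ _ euv Cq zq zu zv.
  have fq' := far_near _ _ _ _ euv' Cq' zq' zu' zv'.
  have [E|E] := eqVneq [set u; v]%SET [set u'; v']%SET; last first.
    have qq' : grid_close 2 (cl q) (cl q').
      by rewrite -[2%N]/(1 + 1)%N; apply: grid_close_trans zq'; rewrite grid_close_sym.
    case: (sep_edge ((u, v), (u', v')) euv euv' E q q' Cq fq Cq' fq').
    have := cell_dist d0 (C_box _ _ _ euv Cq) (C_box _ _ _ euv' Cq') qq'.
    exact: le_ball.
  (* Both pairs are listed by increasing rank, so the same edge has its ends in the same order. *)
  have : u \in [set u'; v']%SET by rewrite -E !inE eqxx.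
  have : v \in [set u'; v']%SET by rewrite -E !inE eqxx orbT.
  rewrite !inE => /orP[] /eqP vE /orP[] /eqP uE; rewrite vE uE // in uv *.
  + by rewrite ltnn in uv.
  + by have := ltn_trans uv uv'; rewrite ltnn.
  + by rewrite ltnn in uv.
Qed.

End PlaneDrawings.

Theorem theorem4 (R : realType) (T : finType) (e : rel T)
    (e_sym : symmetric e) (e_irr : irreflexive e)
    (e_3conn : k_connected e 3) (e_planar : planar R e)
    (e_bip : bipartite e) :
  exists o : rel T,
    proper_orientation e o /\ (forall v : T, (indegree o v <= 6)%N).
Proof.
apply: proper_of_dual => //.
exact: planar_has_dual e_sym e_irr e_planar.
Qed.
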